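(* Suppose that the assumptions (A1)–(A6) on $g,h,c$ hold. Let $(x_k)_{k\in\mathbb N}$ be generated by Algorithm 1 (see context), and suppose that for some $\sigma>0$, $\|\nabla c(x_k)\|_{\mathrm{op}}\le\sigma$ for all $k\in\mathbb N$; that $X^*$ is nonempty; and that for some $1\le r<3$, $\gamma>0$ and $K\in\mathbb N$, $$\frac{\gamma}{r}\operatorname{dist}(x_k,X^* )^r\le F(x_k)-F_\infty\quad\text{for all }k\ge K.$$ Then: (a) If $r=1$, then $F(x_k)=F_\infty$ for some $k\in\mathbb N$. (b) If $1<r<2$ and $\Delta_\infty=0$, then $(F(x_k))_{k\in\mathbb N}$ converges with order $\frac{r+2}{2(r-1)}$. (c) If $1<r<2$ and $\Delta_\infty>0$, then $(F(x_k))_{k\in\mathbb N}$ converges with order $\frac1{r-1}$. (d) If $2\le r<3$ and $\Delta_\infty=0$, then $(F(x_k))_{k\in\mathbb N}$ converges with order $\frac{2}{r-1}$. (e) If $r=2$ and $0<\Delta_\infty<1/C_3^2$, then $(F(x_k))_{k\in\mathbb N}$ converges with order $1$ (i.e., linearly).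
   Context: Problem. Minimize $F(x)=g(x)+h(c(x))$ over $x\in\mathbb R^d$, with $g:\mathbb R^d\to\mathbb R\cup\{+\infty\}$, $h:\mathbb R^n\to\mathbb R$ differentiable and $c:\mathbb R^d\to\mathbb R^n$ continuously differentiable with Jacobian $\nabla c(x)\in\mathbb R^{n\times d}$. $\|\cdot\|$ is the Euclidean norm, $\|\cdot\|_{\mathrm{op}}$ the spectral norm, $\operatorname{dom} g=\{x: g(x)<+\infty\}$. Assumptions: (A1) $g$ is proper closed convex; (A2) $h$ is convex; (A3) $\inf g>-\infty$; (A4) $\inf h>-\infty$; (A5) there is $L_h>0$ with $\|\nabla h(y)-\nabla h(x)\|\le L_h\|y-x\|$ for all $x,y\in\mathbb R^n$; (A6) there is $L_c>0$ with $\|\nabla c(y)-\nabla c(x)\|_{\mathrm{op}}\le L_c\|y-x\|$ for all $x,y\in\operatorname{dom} g$. Fixed numbers $g^*,h^*\in\mathbb R$ satisfy $g^*\le\inf g$, $h^*\le\inf h$. Notation. $H(x)=h(c(x))$, $\Delta_k=F(x_k)-(g^*+h^* )\ge0$. For $x_k\in\operatorname{dom} g$ and $\mu>0$: $\bar H_{k,\mu}(x)=h(c(x_k)+\nabla c(x_k)(x-x_k))+\frac{\mu}{2}\|x-x_k\|^2$. With $\partial g$ the convex subdifferential, $\omega(x)=\min_{p\in\partial g(x)}\|p+\nabla H(x)\|$ and $\bar\omega_{k,\mu}(x)=\min_{p\in\partial g(x)}\|p+\nabla\bar H_{k,\mu}(x)\|$ (value $+\infty$ if $\partial g(x)=\emptyset$).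 $S_{k,\mu}=\{x\in\operatorname{dom} g:\bar\omega_{k,\mu}(x)\le\theta\mu\|x-x_k\|\}$. Algorithm 1. Input: $x_0\in\operatorname{dom} g$, $0<\theta<1$, $\rho_{\min}>0$, $\alpha>1$, $g^*,h^*$. Set $\rho\leftarrow\rho_{\min}$. For $k=0,1,\dots$: (i) set $\mu\leftarrow\rho\sqrt{F(x_k)-(g^*+h^* )}$; (ii) find some $x\in S_{k,\mu}$; (iii) if $F(x)\le F(x_k)-\frac{1-\theta}{2}\mu\|x-x_k\|^2$ does not hold, set $\rho\leftarrow\alpha\rho$ and go back to (i); (iv) set $(x_{k+1},\mu_k)\leftarrow(x,\mu)$. Convention: if $\Delta_k=0$, then $x_k$ is a global minimizer and the algorithm stops; the sequences are continued by $x_j=x_k$, $\mu_j=0$ for $j\ge k$. The sequence $(F(x_k))$ is nonincreasing and bounded below. $F_\infty=\lim_k F(x_k)$, $\Delta_\infty=\lim_k\Delta_k=F_\infty-(g^*+h^* )\ge0$, $X^*=\{x\in\operatorname{dom} g:\omega(x)=0,\ F(x)\le F_\infty\}$ (a closed set), $\operatorname{dist}(x,X^* )=\min_{y\in X^*}\|y-x\|$. Constants: $\rho_{\max}=\alpha\frac{L_c\sqrt{2L_h}}{1-\theta}$ if $\rho_{\min}<\frac{L_c\sqrt{2L_h}}{1-\theta}$ and $\rho_{\max}=\rho_{\min}$ otherwise; $C_1=\frac{L_c\sqrt{2L_h}}{(1-\theta)\rho_{\min}}+\frac1{\sqrt{1-\theta^2}}$; $C_2=(1+\theta)\rho_{\max}+L_c\sqrt{2L_h}$;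 $C_3=2C_1C_2(r/\gamma)^{2/r}$. ''$(F(x_k))$ converges with order $p$'' means: with $\delta_k=F(x_k)-F_\infty$, there are $C\ge0$ and $k_0$ such that $\delta_{k+1}\le C\,\delta_k^{\,p}$ for all $k\ge k_0$, where for $p=1$ one requires $C<1$. *)

(* Defs.v *)
From HB Require Import structures.
From mathcomp Require Import all_boot all_order all_algebra.
From mathcomp Require Import all_classical all_reals all_analysis.

Set Implicit Arguments.
Unset Strict Implicit.
Unset Printing Implicit Defensive.

Import Order.TTheory GRing.Theory Num.Theory.
Import numFieldNormedType.Exports.

Local Open Scope classical_set_scope.
Local Open Scope ring_scope.

(* Setting: MathComp-Analysis, over an arbitrary [R : realType].  Points of
   R^m are row vectors ['rV[R]_m].  The library norm [`|v|] on matrices is the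
   sup norm; it is used here only through the topology and the differential,
   which depend on the norm only up to equivalence.  The metric quantities are
   all expressed with the Euclidean norm [enorm]. *)

Definition dotp (R : realType) (m : nat) (u v : 'rV[R]_m) : R :=
  \sum_i u 0 i * v 0 i.

Definition enorm (R : realType) (m : nat) (v : 'rV[R]_m) : R :=
  Num.sqrt (\sum_i v 0 i ^+ 2).

(* In the row-vector convention a matrix acts on the right, [v |-> v *m A], and
   the library Jacobian ['J f x], of size (m, n) for f : R^m -> R^n, is the
   transpose of the usual n x m matrix: the derivative of f at x in the
   direction v is [v *m 'J f x]. *)
Definition opnorm (R : realType) (m n : nat) (A : 'M[R]_(m, n)) : R :=
  sup [set enorm (v *m A) | v in [set v : 'rV[R]_m | enorm v <= 1]].

Definition gradient (R : realType) (m : nat) (f : 'rV[R]_m -> R)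
    (x : 'rV[R]_m) : 'rV[R]_m :=
  \row_i 'D_(delta_mx 0 i) f x.

Definition dist_to (R : realType) (m : nat) (x : 'rV[R]_m)
    (A : set 'rV[R]_m) : R :=
  inf [set enorm (y - x) | y in A].

Definition edom (R : realType) (m : nat) (g : 'rV[R]_m -> \bar R) :
    set 'rV[R]_m :=
  [set x | (g x < +oo)%E].

Definition proper_efun (R : realType) (m : nat) (g : 'rV[R]_m -> \bar R) : Prop :=
  (forall x, (-oo < g x)%E) /\ edom g !=set0.

Definition convex_efun (R : realType) (m : nat) (g : 'rV[R]_m -> \bar R) :
    Prop :=
  forall (x y : 'rV[R]_m) (t : R), 0 <= t -> t <= 1 ->
    (g (t *: x + (1 - t) *: y)%R <= t%:E * g x + (1 - t)%:E * g y)%E.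

Definition subdifferential (R : realType) (m : nat) (g : 'rV[R]_m -> \bar R)
    (x : 'rV[R]_m) : set 'rV[R]_m :=
  [set p | forall y, (g x + (dotp p (y - x))%:E <= g y)%E].

(* The distance from 0 to (subdifferential of g) + (gradient of G) at x.  The
   subdifferential is closed, so this infimum is a minimum when it is nonempty;
   when it is empty the value is [+oo]. *)
Definition residual (R : realType) (m : nat) (g : 'rV[R]_m -> \bar R)
    (G : 'rV[R]_m -> R) (x : 'rV[R]_m) : \bar R :=
  ereal_inf [set (enorm (p + gradient G x))%:E | p in subdifferential g x].

Definition objective (R : realType) (d n : nat) (g : 'rV[R]_d -> \bar R)
    (h : 'rV[R]_n -> R) (c : 'rV[R]_d -> 'rV[R]_n) (x : 'rV[R]_d) : \bar R :=
  (g x + (h (c x))%:E)%E.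

(* [fine] is the projection to R; it is applied only to points of [edom g],
   where the objective is finite. *)
Definition Fval (R : realType) (d n : nat) (g : 'rV[R]_d -> \bar R)
    (h : 'rV[R]_n -> R) (c : 'rV[R]_d -> 'rV[R]_n) (x : 'rV[R]_d) : R :=
  fine (objective g h c x).

Definition model (R : realType) (d n : nat) (h : 'rV[R]_n -> R)
    (c : 'rV[R]_d -> 'rV[R]_n) (xk : 'rV[R]_d) (mu : R) (x : 'rV[R]_d) : R :=
  h (c xk + (x - xk) *m 'J c xk) + mu / 2 * enorm (x - xk) ^+ 2.

Definition candidates (R : realType) (d n : nat) (g : 'rV[R]_d -> \bar R)
    (h : 'rV[R]_n -> R) (c : 'rV[R]_d -> 'rV[R]_n) (theta : R)
    (xk : 'rV[R]_d) (mu : R) : set 'rV[R]_d :=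
  [set x | edom g x /\
    (residual g (model h c xk mu) x <= (theta * mu * enorm (x - xk))%:E)%E].

Definition sufficient_decrease (R : realType) (d n : nat)
    (g : 'rV[R]_d -> \bar R) (h : 'rV[R]_n -> R) (c : 'rV[R]_d -> 'rV[R]_n)
    (theta : R) (xk : 'rV[R]_d) (mu : R) (x : 'rV[R]_d) : Prop :=
  (objective g h c x <=
     objective g h c xk - ((1 - theta) / 2 * mu * enorm (x - xk) ^+ 2)%:E)%E.

Definition penalty (R : realType) (d n : nat) (g : 'rV[R]_d -> \bar R)
    (h : 'rV[R]_n -> R) (c : 'rV[R]_d -> 'rV[R]_n) (gs hs : R)
    (xk : 'rV[R]_d) (rho : R) : R :=
  rho * Num.sqrt (Fval g h c xk - (gs + hs)).

(* [search ... xk rho x mu rho']: the inner loop at the iterate [xk], entered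
   with the current value [rho], may exit with [x_(k+1) = x], [mu_k = mu] and
   leave the value [rho'] of the variable rho for the next iteration.  The
   candidate is an arbitrary element of [candidates], at each trial. *)
Inductive search (R : realType) (d n : nat) (g : 'rV[R]_d -> \bar R)
    (h : 'rV[R]_n -> R) (c : 'rV[R]_d -> 'rV[R]_n) (theta alpha gs hs : R)
    (xk : 'rV[R]_d) : R -> 'rV[R]_d -> R -> R -> Prop :=
| search_accept (rho : R) (x : 'rV[R]_d) :
    candidates g h c theta xk (penalty g h c gs hs xk rho) x ->
    sufficient_decrease g h c theta xk (penalty g h c gs hs xk rho) x ->
    search g h c theta alpha gs hs xk rho x (penalty g h c gs hs xk rho) rho
| search_reject (rho : R) (x' x : 'rV[R]_d) (mu rho' : R) :
    candidates g h c theta xk (penalty g h c gs hs xk rho) x' ->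
    ~ sufficient_decrease g h c theta xk (penalty g h c gs hs xk rho) x' ->
    search g h c theta alpha gs hs xk (alpha * rho) x mu rho' ->
    search g h c theta alpha gs hs xk rho x mu rho'.

(* [rho k] is the value of the variable rho at the beginning of iteration k; it
   is not reset between iterations. *)
Definition algorithm_run (R : realType) (d n : nat) (g : 'rV[R]_d -> \bar R)
    (h : 'rV[R]_n -> R) (c : 'rV[R]_d -> 'rV[R]_n)
    (theta rhomin alpha gs hs : R) (x : nat -> 'rV[R]_d) (mu : nat -> R) :
    Prop :=
  edom g (x 0%N) /\
  exists rho : nat -> R, rho 0%N = rhomin /\
    forall k : nat,
      if Fval g h c (x k) - (gs + hs) == 0
      then [/\ x k.+1 = x k, mu k = 0 & rho k.+1 = rho k]
      else search g h c theta alpha gs hs (x k) (rho k) (x k.+1) (mu k)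
             (rho k.+1).

Definition Flim (R : realType) (d n : nat) (g : 'rV[R]_d -> \bar R)
    (h : 'rV[R]_n -> R) (c : 'rV[R]_d -> 'rV[R]_n) (x : nat -> 'rV[R]_d) : R :=
  limn (fun k => Fval g h c (x k)).

Definition gap_lim (R : realType) (d n : nat) (g : 'rV[R]_d -> \bar R)
    (h : 'rV[R]_n -> R) (c : 'rV[R]_d -> 'rV[R]_n) (gs hs : R)
    (x : nat -> 'rV[R]_d) : R :=
  limn (fun k => Fval g h c (x k) - (gs + hs)).

Definition Xstar (R : realType) (d n : nat) (g : 'rV[R]_d -> \bar R)
    (h : 'rV[R]_n -> R) (c : 'rV[R]_d -> 'rV[R]_n) (x : nat -> 'rV[R]_d) :
    set 'rV[R]_d :=
  [set y | [/\ edom g y, residual g (h \o c) y = 0%E &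
              (objective g h c y <= (Flim g h c x)%:E)%E]].

Definition rho_max (R : realType) (Lc Lh theta rhomin alpha : R) : R :=
  if rhomin < Lc * Num.sqrt (2 * Lh) / (1 - theta)
  then alpha * (Lc * Num.sqrt (2 * Lh) / (1 - theta))
  else rhomin.

Definition C1 (R : realType) (Lc Lh theta rhomin : R) : R :=
  Lc * Num.sqrt (2 * Lh) / ((1 - theta) * rhomin) +
  1 / Num.sqrt (1 - theta ^+ 2).

Definition C2 (R : realType) (Lc Lh theta rhomin alpha : R) : R :=
  (1 + theta) * rho_max Lc Lh theta rhomin alpha + Lc * Num.sqrt (2 * Lh).

Definition C3 (R : realType) (Lc Lh theta rhomin alpha r gamma : R) : R :=
  2 * C1 Lc Lh theta rhomin * C2 Lc Lh theta rhomin alpha *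
  (r / gamma) `^ (2 / r).

Definition converges_with_order (R : realType) (u : nat -> R) (l p : R) :
    Prop :=
  exists (C : R) (k0 : nat),
    [/\ 0 <= C, p = 1 -> C < 1 &
        forall k : nat, (k0 <= k)%N -> u k.+1 - l <= C * (u k - l) `^ p].

(* Main.v *)
Require Import Defs.
From HB Require Import structures.
From mathcomp Require Import all_boot all_order all_algebra.
From mathcomp Require Import all_classical all_reals all_analysis.
From mathcomp Require Import ring lra.
Import Order.TTheory GRing.Theory Num.Theory.
Import numFieldNormedType.Exports.
Local Open Scope classical_set_scope.
Local Open Scope ring_scope.

(** Write [s = x k.+1 - x k], [D] for the distance from [x k] to the set of stationary
    points of value at most the limit, [dl] for the excess [F (x k) - Finf] and [gap]
    for [F (x k) - (gs + hs)], so that [gap = dl + Dinf].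

    The penalty is [mu = rho * sqrt gap].  Because [h] is bounded below and has a
    Lipschitz gradient, its gradient is at most [sqrt (2 * Lh * gap)]
    ([gradient_sqr_le]); hence the error of linearizing [c] inside [h] is also
    proportional to [sqrt gap], trial steps are accepted as soon as [rho] exceeds a
    fixed threshold ([accepted_of_large_penalty]), and [rho] stays in
    [[rhomin, rho_max]] ([search_spec]).

    Each iteration then obeys the following estimates.
    - The next point has a subgradient of norm at most
      [C2 * sqrt gap * enorm s + O(enorm s ^+ 2)] ([residual_next_le]), and by weak
      convexity of [h \o c] the next excess is at most this norm times the next
      distance, plus a small term ([gap_next_le]).
    - The step is not much longer than the distance:
      [enorm s <= C1 * D + O(D ^+ 2 / sqrt gap)] ([step_le_dist]), from the
      monotonicity of the subdifferential and a planar angle estimate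
      ([angle_bound]).  If [Dinf = 0], strong convexity of the model and the
      vanishing of the gradient of [h] give
      [enorm s ^+ 2 <= O(D ^+ 2 + D ^+ 4 / sqrt gap)] ([step_le_dist_zero_gap]), which
      stays useful when the growth exponent [r] exceeds 2.
    All of them hold for every point of the stationary set and pass to the infimum
    ([le_horner_dist]).

    The growth condition bounds [D] by a multiple of [dl `^ q] with [q = 1 / r].
    Inserting it gives [dl k.+1 <= B * dl k `^ e * dl k.+1 `^ q], where [e] is
    [min (1 / 2 + q) (2 * q)] if [Dinf = 0] ([recursion_zero_gap]) and [q] if
    [Dinf > 0] ([recursion_pos_gap]).  For [q < 1] this is convergence of order
    [e / (1 - q)] ([order_of_recursion]); for [q = 1] it is impossible when [dl] is
    small and positive ([finite_of_recursion]).  In the borderline case [r = 2] and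
    [Dinf > 0] the order is 1 and the constants decide ([linear_rate]). *)

(** * Euclidean geometry of row vectors *)

Section euclid.
Context {R : realType} {m : nat}.
Implicit Types u v w : 'rV[R]_m.

Lemma dotpC u v : dotp u v = dotp v u.
Proof. by apply: eq_bigr => i _; rewrite mulrC. Qed.

Lemma dotpDl u v w : dotp (u + v) w = dotp u w + dotp v w.
Proof. by rewrite -big_split; apply: eq_bigr => i _; rewrite mxE mulrDl. Qed.

Lemma dotpZl a u v : dotp (a *: u) v = a * dotp u v.
Proof. by rewrite /dotp mulr_sumr; apply: eq_bigr => i _; rewrite mxE mulrA. Qed.

Lemma dotpNl u v : dotp (- u) v = - dotp u v.
Proof. by rewrite -scaleN1r dotpZl mulN1r. Qed.

Lemma dotpDr u v w : dotp u (v + w) = dotp u v + dotp u w.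
Proof. by rewrite dotpC dotpDl !(dotpC _ u). Qed.

Lemma dotpZr a u v : dotp u (a *: v) = a * dotp u v.
Proof. by rewrite dotpC dotpZl dotpC. Qed.

Lemma dotpNr u v : dotp u (- v) = - dotp u v.
Proof. by rewrite dotpC dotpNl dotpC. Qed.

Definition dotpE := (dotpDl, dotpDr, dotpNl, dotpNr, dotpZl, dotpZr).

Lemma enorm_ge0 u : 0 <= enorm u.
Proof. exact: sqrtr_ge0. Qed.

Lemma dotpp u : dotp u u = enorm u ^+ 2.
Proof.
rewrite /enorm sqr_sqrtr; last by apply: sumr_ge0 => i _; exact: sqr_ge0.
by apply: eq_bigr => i _; rewrite expr2.
Qed.

Lemma enorm_eq0 u : enorm u = 0 -> u = 0.
Proof.
rewrite /enorm => /eqP; rewrite sqrtr_eq0 => vle.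
have v2i (j : 'I_m) : true -> 0 <= u 0 j ^+ 2 by rewrite sqr_ge0.
have : \sum_i0 u 0 i0 ^+ 2 == 0 by rewrite eq_le vle sumr_ge0.
rewrite psumr_eq0// => /allP H; apply/rowP => i; rewrite mxE.
have := H i; rewrite mem_index_enum => /(_ isT).
by rewrite sqrf_eq0 => /eqP ->.
Qed.

Lemma dotp_le u v : dotp u v <= enorm u * enorm v.
Proof.
have uv : dotp u v ^+ 2 <= (enorm u * enorm v) ^+ 2.
  rewrite exprMn -!dotpp.
  have : 0 <= dotp (dotp v v *: u - dotp u v *: v) (dotp v v *: u - dotp u v *: v).
    by rewrite dotpp sqr_ge0.
  rewrite !dotpE (dotpC v u) => H.
  have vv0 : 0 <= dotp v v by rewrite dotpp sqr_ge0.
  have [v0|v0] := eqVneq (dotp v v) 0.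
    have {}v0 : enorm v = 0 by apply/eqP; rewrite -sqrf_eq0 -dotpp v0.
    have -> : dotp u v = 0.
      by rewrite (enorm_eq0 v v0) /dotp big1// => i _; rewrite mxE mulr0.
    by rewrite expr0n mulr_ge0// dotpp sqr_ge0.
  have {}vv0 : 0 < dotp v v by rewrite lt_def v0.
  have : 0 <= dotp v v * (dotp u u * dotp v v - dotp u v ^+ 2) by lra.
  by rewrite pmulr_rge0// subr_ge0.
have uv0 : 0 <= enorm u * enorm v by rewrite mulr_ge0 ?enorm_ge0.
rewrite leNgt; apply/negP => lt; move: uv; apply/negP; rewrite -ltNge.
by rewrite ltr_pXn2r// nnegrE ltW// (le_lt_trans uv0).
Qed.

Lemma enormN u : enorm (- u) = enorm u.
Proof. by congr Num.sqrt; apply: eq_bigr => i _; rewrite mxE sqrrN. Qed.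

Lemma enormB u v : enorm (u - v) = enorm (v - u).
Proof. by rewrite -enormN opprB. Qed.

Lemma ge0_sqr_inj a b : 0 <= a -> 0 <= b -> a ^+ 2 = b ^+ 2 :> R -> a = b.
Proof. by move=> a0 b0 /eqP; rewrite eqrXn2// => /eqP. Qed.

Lemma enormZ a u : enorm (a *: u) = `|a| * enorm u.
Proof.
apply: ge0_sqr_inj; rewrite ?mulr_ge0 ?enorm_ge0//.
by rewrite -dotpp !dotpE dotpp exprMn real_normK ?num_real//; ring.
Qed.

Lemma enorm0 : enorm (0 : 'rV[R]_m) = 0.
Proof. by rewrite -(scale0r 0) enormZ normr0 mul0r. Qed.

Lemma enorm_gt0 u : u != 0 -> 0 < enorm u.
Proof.
by move=> u0; rewrite lt_def enorm_ge0 andbT; apply: contra_neq u0; exact: enorm_eq0.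
Qed.

Lemma enormD u v : enorm (u + v) <= enorm u + enorm v.
Proof.
rewrite -ler_sqr ?nnegrE ?addr_ge0 ?enorm_ge0// -dotpp !dotpE !dotpp (dotpC v u).
have := dotp_le u v; lra.
Qed.

Lemma dotp_ge u v : - (enorm u * enorm v) <= dotp u v.
Proof. by have := dotp_le (- u) v; rewrite dotpNl enormN; lra. Qed.

Lemma enorm_dual_le w B : 0 <= B -> (forall v, dotp w v <= B * enorm v) -> enorm w <= B.
Proof.
move=> B0 H; have [->|w0] := eqVneq w 0; first by rewrite enorm0.
by have := H w; rewrite dotpp expr2 ler_pM2r// enorm_gt0.
Qed.

Lemma coord_le_enorm u i : `|u 0 i| <= enorm u.
Proof.
rewrite -(@ler_sqr _ `|_|) ?nnegrE ?enorm_ge0// real_normK ?num_real//.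
rewrite -dotpp /dotp (bigD1 i)//= -expr2 lerDl.
by apply: sumr_ge0 => j _; rewrite -expr2 sqr_ge0.
Qed.

End euclid.

Section opnorm.
Context {R : realType} {m n : nat}.
Implicit Types A : 'M[R]_(m, n).

(** In the row-vector convention the transpose is the adjoint. *)
Lemma dotp_mulmx A (v : 'rV[R]_m) (w : 'rV[R]_n) :
  dotp (v *m A) w = dotp v (w *m A^T).
Proof.
rewrite /dotp.
under eq_bigr do rewrite mxE mulr_suml.
rewrite exchange_big/=; apply: eq_bigr => i _.
rewrite [in RHS]mxE mulr_sumr; apply: eq_bigr => j _.
by rewrite mxE -mulrA [A i j * _]mulrC.
Qed.

(** The Frobenius norm of [A] is an upper bound, so that [opnorm A] is a true
    supremum and not the default value of [sup]. *)
Lemma opnorm_has_sup A :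
  has_sup [set enorm (v *m A) | v in [set v : 'rV[R]_m | enorm v <= 1]].
Proof.
split; first by exists (enorm (0 *m A)); exists 0 => //=; rewrite enorm0.
exists (Num.sqrt (\sum_(j < n) enorm (col j A)^T ^+ 2)) => _ [v /= v1 <-].
apply: ler_wsqrtr; apply: ler_sum => j _.
have -> : (v *m A) 0 j = dotp v (col j A)^T.
  by rewrite mxE; apply: eq_bigr => i _; rewrite !mxE.
rewrite -[leLHS]real_normK ?num_real// ler_sqr ?nnegrE ?enorm_ge0//.
have c0 := enorm_ge0 (col j A)^T; have v0 := enorm_ge0 v.
have H := dotp_le v (col j A)^T; have H' := dotp_ge v (col j A)^T.
by rewrite ler_norml; apply/andP; split; nra.
Qed.

Lemma opnorm_ge0 A : 0 <= opnorm A.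
Proof.
have /ub_le_sup/(_ (enorm (0 *m A))) := (opnorm_has_sup A).2.
by rewrite mul0mx enorm0; apply; exists 0; rewrite /= ?mul0mx ?enorm0.
Qed.

Lemma enorm_mulmx_le A (v : 'rV[R]_m) : enorm (v *m A) <= opnorm A * enorm v.
Proof.
have [->|v0] := eqVneq v 0; first by rewrite mul0mx !enorm0 mulr0.
have v0' := enorm_gt0 _ v0.
have : enorm (((enorm v)^-1 *: v) *m A) <= opnorm A.
  apply: (ub_le_sup (opnorm_has_sup A).2); eexists; last reflexivity.
  by rewrite /= enormZ ger0_norm ?invr_ge0 ?enorm_ge0// mulVf// gt_eqF.
rewrite -scalemxAl enormZ ger0_norm ?invr_ge0 ?enorm_ge0//.
by rewrite mulrC ler_pdivrMr.
Qed.

(** A matrix and its transpose have the same operator norm; by duality the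
    inequality needed here follows from the one for [A]. *)
Lemma enorm_mulmx_tr_le A (w : 'rV[R]_n) : enorm (w *m A^T) <= opnorm A * enorm w.
Proof.
apply: enorm_dual_le => [|v]; first by rewrite mulr_ge0 ?opnorm_ge0 ?enorm_ge0.
rewrite dotpC -dotp_mulmx mulrAC.
apply: le_trans (dotp_le _ _) _.
by rewrite ler_wpM2r ?enorm_ge0// enorm_mulmx_le.
Qed.

End opnorm.

Section angle.
Context {R : realType} {m : nat}.
Implicit Types s q u d : 'rV[R]_m.

(** As a function of [e] the right-hand side is concave, with value 1 at [0] and
    0 at [1 - th]; the left-hand side is its chord. *)
Lemma sqrt_chord (th e : R) : 0 < th -> th < 1 -> 0 <= e -> e <= 1 - th ->
  1 - e / (1 - th) <= Num.sqrt (1 - (th + e) ^+ 2) / Num.sqrt (1 - th ^+ 2).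
Proof.
move=> th0 th1 e0 e1.
have t1 : 0 < 1 - th by lra.
have t2 : 0 < 1 - th ^+ 2 by nra.
have x0 : 0 <= 1 - e / (1 - th) by rewrite subr_ge0 ler_pdivrMr// mul1r.
rewrite ler_pdivlMr ?sqrtr_gt0// -(@ger0_norm _ (1 - _ / _))// -sqrtr_sqr -sqrtrM ?sqr_ge0//.
apply: ler_wsqrtr.
have -> : (1 - e / (1 - th)) ^+ 2 * (1 - th ^+ 2) = (1 - th - e) ^+ 2 * (1 + th) / (1 - th).
  by field; lra.
rewrite ler_pdivrMr//.
have : 0 <= (1 - th - e) * e by nra.
nra.
Qed.

(** If [u = 0], the vector [a = s + q] makes with [s] an angle whose sine is at
    most [th], while [dotp a s <= dotp a d]; hence the factor
    [1 / sqrt (1 - th^2)].  A perturbation [u] with [enorm u = e * enorm s]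
    enlarges the sine to [th + e], and [sqrt_chord] turns this into an additive
    error.  This is the source of the two summands of the constant [C1]. *)
Lemma angle_bound (th : R) s q u d : 0 < th -> th < 1 ->
  enorm q <= th * enorm s -> 0 <= dotp (s + q + u) (d - s) ->
  enorm s <= enorm u / (1 - th) + enorm d / Num.sqrt (1 - th ^+ 2).
Proof.
move=> th0 th1 qs H.
have t1 : 0 < 1 - th by lra.
have t2 : 0 < Num.sqrt (1 - th ^+ 2) by rewrite sqrtr_gt0; nra.
(* Otherwise the sine bound [th + e] below would not be less than 1. *)
have [us|su] := leP ((1 - th) * enorm s) (enorm u).
  apply: (@le_trans _ _ (enorm u / (1 - th))).
    by rewrite ler_pdivlMr// mulrC.
  by rewrite lerDl divr_ge0 ?enorm_ge0// ltW.
have s0 : 0 < enorm s.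
  rewrite lt_def enorm_ge0 andbT; apply/eqP => s0.
  by have := enorm_ge0 u; move: su; rewrite s0; lra.
pose e := enorm u / enorm s.
have e0 : 0 <= e by rewrite divr_ge0 ?enorm_ge0.
have ue : enorm u = e * enorm s by rewrite /e divfK// gt_eqF.
have e1 : e < 1 - th by rewrite /e ltr_pdivrMr.
have C := sqrt_chord th e th0 th1 e0 (ltW e1).
set S := Num.sqrt (1 - (th + e) ^+ 2) in C.
have S2 : S ^+ 2 = 1 - (th + e) ^+ 2 by rewrite sqr_sqrtr//; nra.
have S0 : 0 <= S by exact: sqrtr_ge0.
suff dS : S * enorm s <= enorm d.
  rewrite ue.
  have dS' : S / Num.sqrt (1 - th ^+ 2) * enorm s <= enorm d / Num.sqrt (1 - th ^+ 2).
    by rewrite mulrAC ler_wpM2r// invr_ge0 ltW.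
  apply: le_trans (lerD (lexx _) dS').
  have -> : e * enorm s / (1 - th) = e / (1 - th) * enorm s by rewrite mulrAC.
  rewrite -mulrDl -[leLHS]mul1r ler_wpM2r ?enorm_ge0//; lra.
set a := s + q + u in H.
have qu : enorm (q + u) <= (th + e) * enorm s.
  by apply: le_trans (enormD _ _) _; rewrite ue mulrDl lerD2r.
have qu2 : enorm (q + u) ^+ 2 <= (th + e) ^+ 2 * enorm s ^+ 2.
  by rewrite -exprMn ler_sqr// nnegrE ?enorm_ge0// mulr_ge0 ?enorm_ge0//; lra.
have a2 : enorm a ^+ 2 = 2 * dotp a s - enorm s ^+ 2 + enorm (q + u) ^+ 2.
  rewrite -!dotpp /a !dotpE (dotpC q s) (dotpC u s) (dotpC u q); ring.
have as_ : enorm a ^+ 2 + S ^+ 2 * enorm s ^+ 2 <= 2 * dotp a s by rewrite S2; lra.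
have ad : dotp a s <= enorm a * enorm d.
  apply: le_trans (dotp_le _ _); move: H; rewrite dotpDr dotpNr; lra.
have a0 : 0 < enorm a.
  rewrite lt_def enorm_ge0 andbT; apply/eqP => a0.
  have : 0 < S ^+ 2 by rewrite S2; nra.
  move: as_ ad; rewrite a0 expr0n/= mul0r add0r => X Y Z.
  have : 0 < S ^+ 2 * enorm s ^+ 2 by rewrite mulr_gt0// exprn_gt0.
  lra.
have : 2 * (enorm a * (S * enorm s)) <= 2 * (enorm a * enorm d).
  have := sqr_ge0 (enorm a - S * enorm s); nra.
by rewrite ler_pM2l// ler_pM2l.
Qed.

End angle.

(** * Gradients, descent and linearization *)

Section line_calculus.
Context {R : realType}.

Lemma segment_point {V : lmodType R} (x w : V) (t : R) :
  x + t *: w = t *: (x + w) + (1 - t) *: x.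
Proof.
by rewrite scalerDr scalerBl scale1r addrC [RHS]addrC addrA subrK addrC.
Qed.

Lemma is_derive_line {W : normedModType R} {m : nat} (f : 'rV[R]_m -> W)
    (a v : 'rV[R]_m) (t : R) :
  differentiable f (a + t *: v) ->
  is_derive t 1 (fun t => f (a + t *: v)) ('D_v f (a + t *: v)).
Proof.
move=> df.
have dl : is_diff t (fun t : R => a + t *: v) (fun h => h *: v).
  by apply: is_diff_eq; rewrite add0r.
have df' : differentiable (f \o (fun t : R => a + t *: v)) t.
  exact: differentiable_comp.
apply: DeriveDef; first exact/derivable1_diffP.
rewrite deriveE// diff_comp//= deriveE//.
by have /(congr1 (fun f => f 1)) /= -> := @diff_val _ _ _ _ _ _ _ dl; rewrite scale1r.
Qed.

(** A directional derivative only sees the restriction to a line. *)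
Lemma is_derive_along {W : normedModType R} {m : nat} (f : 'rV[R]_m -> W)
    (a v : 'rV[R]_m) (D : W) :
  is_derive (0 : R) 1 (fun t : R => f (a + t *: v)) D -> is_derive a v f D.
Proof.
have E : (fun t : R => t^-1 *: (f (a + (t *: 1 + 0) *: v) - f (a + 0 *: v))) =
    (fun t : R => t^-1 *: (f (t *: v + a) - f a)).
  apply/funext => t; rewrite scale0r !addr0 [t *: 1]mulr1.
  by rewrite [a + _]addrC.
move=> H; apply: DeriveDef.
  by have := @ex_derive _ _ _ _ _ _ _ H; rewrite /derivable E.
by have := @derive_val _ _ _ _ _ _ _ H; rewrite /derive E.
Qed.

(** Mean value theorem for [f] minus the primitive [a * t + b / 2 * t ^+ 2]; it
    stands in for the integral form of the Taylor remainder. *)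
Lemma increment_le_affine (f df : R -> R) (a b : R) :
  (forall t : R, is_derive t 1 f (df t)) ->
  (forall t, 0 < t -> t < 1 -> df t <= a + b * t) ->
  f 1 - f 0 <= a + b / 2.
Proof.
move=> fd dfle.
pose phi (t : R) := f t - (a * t + b / 2 * t ^+ 2).
have dphi (t : R) : is_derive t 1 phi (df t - (a + b * t)).
  by apply: is_derive_eq; rewrite /GRing.scale/=; lra.
have cphi : {within `[0, 1], continuous phi}.
  by apply: derivable_within_continuous => u _; exact: ex_derive.
have [s] := MVT (@ltr01 R) (fun u _ => dphi u) cphi.
rewrite in_itv => /andP[s0 s1].
rewrite /phi => E; have := dfle s s0 s1; move: E; rewrite subr0 mulr1; lra.
Qed.

Lemma derive_gradient {m : nat} (f : 'rV[R]_m -> R) (a v : 'rV[R]_m) :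
  differentiable f a -> 'D_v f a = dotp (gradient f a) v.
Proof.
move=> df; rewrite deriveE// {1}[v]row_sum_delta linear_sum/=.
by apply: eq_bigr => i _; rewrite linearZ/= mxE deriveE// mulrC.
Qed.

Lemma gradient_eq {m : nat} (f : 'rV[R]_m -> R) (a w : 'rV[R]_m) :
  (forall v, 'D_v f a = dotp w v) -> gradient f a = w.
Proof.
move=> H; apply/rowP => i; rewrite mxE H /dotp (bigD1 i)//= big1 ?addr0.
  by rewrite mxE !eqxx mulr1.
by move=> j ji; rewrite mxE eqxx (negbTE ji) mulr0.
Qed.

End line_calculus.

Section smooth_convex.
Context {R : realType} {n : nat} (h : 'rV[R]_n -> R) (L : R).
Hypothesis h_diff : forall y, differentiable h y.
Hypothesis h_lip :
  forall y z, enorm (gradient h z - gradient h y) <= L * enorm (z - y).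
Hypothesis L_gt0 : 0 < L.

Let h_line (y w : 'rV[R]_n) (t : R) :
  is_derive t 1 (fun t => h (y + t *: w)) (dotp (gradient h (y + t *: w)) w).
Proof. by rewrite -derive_gradient//; exact: is_derive_line. Qed.

(** The two halves of the descent lemma for a function with Lipschitz gradient. *)
Lemma descent_upper y w :
  h (y + w) <= h y + dotp (gradient h y) w + L / 2 * enorm w ^+ 2.
Proof.
have /= := increment_le_affine _ _ (dotp (gradient h y) w) (L * enorm w ^+ 2)
  (h_line y w).
rewrite scale1r scale0r addr0 => H.
suff : h (y + w) - h y <= dotp (gradient h y) w + L * enorm w ^+ 2 / 2 by lra.
apply: H => t t0 t1.
have := dotp_le (gradient h (y + t *: w) - gradient h y) w.
have := h_lip y (y + t *: w).
rewrite [y + _ - y]addrC addKr enormZ (ger0_norm (ltW t0)) dotpDl dotpNl.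
have := enorm_ge0 w => w0 e1 e2.
have : enorm (gradient h (y + t *: w) - gradient h y) * enorm w <=
  L * (t * enorm w) * enorm w by rewrite ler_wpM2r.
lra.
Qed.

Lemma descent_lower y w :
  h y + dotp (gradient h y) w - L / 2 * enorm w ^+ 2 <= h (y + w).
Proof.
have dn (t : R) : is_derive t 1 (fun t => - h (y + t *: w)) (- dotp (gradient h (y + t *: w)) w).
  by apply: is_deriveN; exact: h_line.
have /= := increment_le_affine _ _ (- dotp (gradient h y) w) (L * enorm w ^+ 2) dn.
rewrite scale1r scale0r addr0 => H.
suff : - h (y + w) - - h y <= - dotp (gradient h y) w + L * enorm w ^+ 2 / 2 by lra.
apply: H => t t0 t1.
have := dotp_ge (gradient h (y + t *: w) - gradient h y) w.
have := h_lip y (y + t *: w).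
rewrite [y + _ - y]addrC addKr enormZ (ger0_norm (ltW t0)) dotpDl dotpNl.
have := enorm_ge0 w => w0 e1 e2.
have : enorm (gradient h (y + t *: w) - gradient h y) * enorm w <=
  L * (t * enorm w) * enorm w by rewrite ler_wpM2r.
lra.
Qed.

(** The descent lemma along a gradient step of length [1 / L] decreases [h] by
    [enorm (gradient h y) ^+ 2 / (2 * L)], and [h] cannot drop below [lb].  Thus
    the gradient is controlled by the optimality gap. *)
Lemma gradient_sqr_le lb y : (forall z, lb <= h z) ->
  enorm (gradient h y) ^+ 2 <= 2 * L * (h y - lb).
Proof.
move=> hlb.
have Li : 0 <= L^-1 by rewrite invr_ge0 ltW.
have := le_trans (hlb _) (descent_upper y (- L^-1 *: gradient h y)).
rewrite dotpZr dotpp enormZ normrN (ger0_norm Li).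
rewrite exprMn => H.
have E : L / 2 * (L^-1 ^+ 2 * enorm (gradient h y) ^+ 2) =
  L^-1 * enorm (gradient h y) ^+ 2 / 2 by field; rewrite gt_eqF.
have : L^-1 * enorm (gradient h y) ^+ 2 <= 2 * (h y - lb) by move: H; rewrite E; lra.
by rewrite ler_pdivrMl// mulrA [L * 2]mulrC.
Qed.

Hypothesis h_conv : convex_function setT h.

(** Convexity compares the increment over [t *: w] with [t] times the full
    increment; the second-order error of the descent lemma is [o(t)]. *)
Lemma gradient_supports y w : h y + dotp (gradient h y) w <= h (y + w).
Proof.
apply/ler_addgt0Pr => e e0.
have w0 := enorm_ge0 w.
(* small enough for the error [t * L * enorm w ^+ 2] to be at most [e] *)
pose t := Num.min 1 (e / (L * (enorm w ^+ 2 + 1))).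
have D0 : 0 < L * (enorm w ^+ 2 + 1) by rewrite mulr_gt0// ltr_wpDl ?sqr_ge0.
have t0 : 0 < t by rewrite lt_min ltr01 divr_gt0.
have t1 : t <= 1 by rewrite ge_min lexx.
have te : t * (L * enorm w ^+ 2) <= e.
  have : t <= e / (L * (enorm w ^+ 2 + 1)) by rewrite ge_min lexx orbT.
  rewrite ler_pdivlMr// => H; apply: le_trans H.
  by apply: ler_wpM2l; [exact: ltW | apply: ler_wpM2l; [exact: ltW | rewrite lerDl]].
have cv : h (y + t *: w) <= t * h (y + w) + (1 - t) * h y.
  have t01 : 0 <= t <= 1 by rewrite (ltW t0).
  have := h_conv (Itv01 (ltW t0) t1) (y + w) y (in_setT _) (in_setT _).
  by rewrite segment_point.
have := descent_lower y (t *: w).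
rewrite dotpZr enormZ (ger0_norm (ltW t0)) => dl.
have : t * dotp (gradient h y) w <= t * (h (y + w) - h y + e / 2).
  have : t * (t * (L * enorm w ^+ 2)) <= t * e by rewrite ler_pM2l.
  rewrite exprMn in dl; lra.
rewrite ler_pM2l//; lra.
Qed.

End smooth_convex.

Section jacobian_calculus.
Context {R : realType} {d n : nat} (c : 'rV[R]_d -> 'rV[R]_n).
Hypothesis c_diff : forall y, differentiable c y.

Lemma dotp_mulmx_le_shift (A B : 'M[R]_(d, n)) w u (M : R) :
  opnorm (A - B) <= M ->
  dotp u (w *m A) <= dotp u (w *m B) + M * enorm w * enorm u.
Proof.
move=> ABM; rewrite -lerBlDl -dotpNr -dotpDr -mulmxBr dotpC.
apply: le_trans (dotp_le _ _) _; apply: ler_wpM2r; first exact: enorm_ge0.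
apply: le_trans (enorm_mulmx_le _ _) _.
by apply: ler_wpM2r => //; exact: enorm_ge0.
Qed.

(** Tested against a fixed vector [u], the error is a real function of the
    segment parameter, whose derivative is at most [L * t * enorm w ^+ 2 * enorm u].
    Only points of the segment matter, so that a Lipschitz condition on a convex
    set suffices. *)
Lemma linearization_error_le (L : R) (x w : 'rV[R]_d) : 0 <= L ->
  (forall t : R, 0 < t -> t < 1 ->
     opnorm ('J c (x + t *: w) - 'J c x) <= L * (t * enorm w)) ->
  enorm (c (x + w) - (c x + w *m 'J c x)) <= L / 2 * enorm w ^+ 2.
Proof.
move=> L0 H; apply: enorm_dual_le => [|u].
  by rewrite mulr_ge0 ?sqr_ge0 ?divr_ge0.
have cd (t : R) : is_derive t 1 (fun t => dotp u (c (x + t *: w)))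
    (dotp u (w *m 'J c (x + t *: w))).
  have di i : is_derive t 1 (fun t => u 0 i * c (x + t *: w) 0 i)
      (u 0 i * (w *m 'J c (x + t *: w)) 0 i).
    have dcoord : is_derive t 1 (fun t => c (x + t *: w) 0 i) ((w *m 'J c (x + t *: w)) 0 i).
      have cl := is_derive_line c x w t (c_diff _).
      have df := @ex_derive _ _ _ _ _ _ _ cl.
      move: (cl); rewrite deriveEjacobian// => cl'.
      have /derivable_mxP dc := df.
      apply: DeriveDef; first exact: dc.
      have := derive_mx df.
      rewrite (@derive_val _ _ _ _ _ _ _ cl') => /rowP/(_ i) ->.
      by rewrite mxE.
    exact: (is_deriveZ (u 0 i) dcoord).
  have -> : (fun t => dotp u (c (x + t *: w))) =
      \sum_i (fun t : R => u 0 i * c (x + t *: w) 0 i).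
    by apply/funext => s; rewrite fct_sumE.
  exact: is_derive_sum di.
have /= := increment_le_affine _ _ (dotp u (w *m 'J c x)) (L * enorm w ^+ 2 * enorm u) cd.
rewrite scale1r scale0r addr0 => H'.
rewrite dotpC !dotpE.
have : dotp u (c (x + w)) - dotp u (c x) <=
  dotp u (w *m 'J c x) + L * enorm w ^+ 2 * enorm u / 2; last by lra.
apply: H' => t t0 t1.
apply: le_trans (dotp_mulmx_le_shift _ _ _ _ _ (H t t0 t1)) _.
rewrite lerD2l le_eqVlt; apply/orP; left; apply/eqP; ring.
Qed.

Variable h : 'rV[R]_n -> R.
Hypothesis h_diff : forall y, differentiable h y.

Lemma gradient_comp x : gradient (h \o c) x = gradient h (c x) *m ('J c x)^T.
Proof.
apply: gradient_eq => v.
rewrite deriveE; last exact: differentiable_comp.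
rewrite diff_comp//= -!deriveE// deriveEjacobian// derive_gradient//.
by rewrite dotp_mulmx trmxK.
Qed.

Lemma derive_enorm_sqr {m : nat} (a x v : 'rV[R]_m) :
  is_derive x v (fun y => enorm (y - a) ^+ 2) (2 * dotp (x - a) v).
Proof.
have -> : (fun y => enorm (y - a) ^+ 2) =
  (fun y : 'rV[R]_m => \sum_i ((y 0 i - a 0 i) ^+ 2)).
  apply/funext => y; rewrite -dotpp; apply: eq_bigr => i _.
  by rewrite !mxE expr2.
have di i : is_derive x v (fun y : 'rV[R]_m => (y 0 i - a 0 i) ^+ 2)
    (2 * ((x 0 i - a 0 i) * v 0 i)).
  have dc : is_derive x v (fun y : 'rV[R]_m => y 0 i) (v 0 i).
    apply: DeriveDef.
      by apply: diff_derivable; exact: differentiable_coord.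
    have df : derivable (id : 'rV[R]_m -> 'rV[R]_m) x v by exact: derivable_id.
    have := derive_mx df; rewrite derive_id => /rowP/(_ i) ->.
    by rewrite mxE.
  apply: is_derive_eq; rewrite /GRing.scale/= subr0; ring.
have -> : (fun y : 'rV[R]_m => \sum_i ((y 0 i - a 0 i) ^+ 2)) =
    \sum_i (fun y : 'rV[R]_m => (y 0 i - a 0 i) ^+ 2).
  by apply/funext => y; rewrite fct_sumE.
apply: is_derive_eq (is_derive_sum di) _.
by rewrite /dotp mulr_sumr; apply: eq_bigr => i _; rewrite !mxE.
Qed.

Lemma gradient_model (xk x : 'rV[R]_d) mu :
  gradient (model h c xk mu) x =
  gradient h (c xk + (x - xk) *m 'J c xk) *m ('J c xk)^T + mu *: (x - xk).
Proof.
apply: gradient_eq => v.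
set A := 'J c xk.
have d1 : is_derive x v (fun y => h (c xk + (y - xk) *m A))
    (dotp (gradient h (c xk + (x - xk) *m A) *m A^T) v).
  apply: is_derive_along.
  have -> : (fun t : R => h (c xk + (x + t *: v - xk) *m A)) =
      (fun t : R => h (c xk + (x - xk) *m A + t *: (v *m A))).
    by apply/funext => t; rewrite addrAC mulmxDl -scalemxAl addrA.
  have := is_derive_line h (c xk + (x - xk) *m A) (v *m A) 0 (h_diff _).
  rewrite derive_gradient// scale0r addr0 => H; apply: is_derive_eq.
  by rewrite dotp_mulmx trmxK.
have d2 := derive_enorm_sqr xk x v.
have d3 : is_derive x v (model h c xk mu) (dotp (gradient h (c xk + (x - xk) *m A) *m A^T) v + mu / 2 *: (2 * dotp (x - xk) v)).
  by apply: is_deriveD.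
rewrite (@derive_val _ _ _ _ _ _ _ d3) !dotpE /GRing.scale/=.
by move: (dotp _ v) (dotp x v) (dotp xk v) => e1 e2 e3; lra.
Qed.

End jacobian_calculus.

(** * Attainment of the residual *)

Section residual_attained.
Context {R : realType} {m : nat}.

Lemma mx_norm_le_enorm (v : 'rV[R]_m) : `|v| <= enorm v.
Proof.
rewrite {1}/Num.norm/= mx_normrE; apply: bigmax_le => [|[i j] _]; first exact: enorm_ge0.
by rewrite ord1 coord_le_enorm.
Qed.

Lemma continuous_dotp (v : 'rV[R]_m) : continuous (fun p : 'rV[R]_m => dotp p v).
Proof.
move=> p; apply: differentiable_continuous.
have -> : (fun p => dotp p v) = \sum_i (fun p : 'rV[R]_m => p 0 i * v 0 i).
  by apply/funext => q; rewrite fct_sumE.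
apply: differentiable_sum => i.
by apply: differentiableM => //; exact: differentiable_coord.
Qed.

Lemma continuous_enorm_shift (w : 'rV[R]_m) : continuous (fun p : 'rV[R]_m => enorm (p + w)).
Proof.
move=> p.
apply: (@continuous_comp _ _ _ (fun p : 'rV[R]_m => \sum_i (p + w) 0 i ^+ 2) Num.sqrt); last exact: sqrt_continuous.
apply: differentiable_continuous.
have -> : (fun p : 'rV[R]_m => \sum_i (p + w) 0 i ^+ 2) =
    \sum_i (fun p : 'rV[R]_m => p 0 i + w 0 i) ^+ 2.
  by apply/funext => q; rewrite fct_sumE; apply: eq_bigr => i _; rewrite !mxE.
apply: differentiable_sum => i.
apply: differentiableX.
by apply: differentiableD => //; exact: differentiable_coord.
Qed.

(** Each point [y] of the domain contributes a closed half-space. *)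
Lemma closed_subdifferential (g : 'rV[R]_m -> \bar R) x :
  (forall y, (-oo < g y)%E) -> edom g x -> closed (subdifferential g x).
Proof.
move=> gNy gx.
have -> : subdifferential g x =
    \bigcap_(y in edom g) ((fun p => dotp p (y - x)) @^-1` [set t | t <= fine (g y) - fine (g x)]).
  have gf y : edom g y -> g y = (fine (g y))%:E.
    by move=> gy; rewrite fineK// fin_numElt gNy.
  apply/seteqP; split => p /= H.
    move=> y gy /=; have := H y; rewrite (gf x gx) (gf y gy) -EFinD lee_fin; lra.
  move=> y; have [gy|] := boolP (g y < +oo)%E.
    have := H y gy => /=; rewrite (gf x gx) (gf y gy) -EFinD lee_fin/=; lra.
  by rewrite -leNgt leye_eq => /eqP ->; rewrite leey.
apply: closed_bigI => y _; apply: preimage_closed; last exact: closed_le.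
by move=> p _; exact: continuous_dotp.
Qed.

(** The subdifferential is closed, so the infimum that defines the residual is a
    minimum over a compact set once a ball around a near-optimal subgradient is
    cut out. *)
Lemma residual_leP (g : 'rV[R]_m -> \bar R) (G : 'rV[R]_m -> R) x B :
  (forall y, (-oo < g y)%E) -> edom g x -> (residual g G x <= B%:E)%E ->
  exists2 p, subdifferential g x p & enorm (p + gradient G x) <= B.
Proof.
move=> gNy gx; set w := gradient G x => resB.
have /ereal_inf_lt [_ [p0 p0g <-]] : (residual g G x < (B + 1)%:E)%E.
  by apply: le_lt_trans resB _; rewrite lte_fin ltrDl.
rewrite lte_fin -/w => p0B.
pose A := subdifferential g x `&` [set p | enorm (p + w) <= B + 1].
have [|||p /set_mem [pg pB] pmin] := @EVT_min_rV R m (fun p : 'rV[R]_m => enorm (p + w)) A.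
- by exists p0; split => //=; exact: ltW.
- apply: bounded_closed_compact.
    exists (B + 1 + enorm w); split; first exact: num_real.
    move=> M /ltW BM p [_ /= pB].
    apply: le_trans (mx_norm_le_enorm _) _; apply: le_trans BM.
    rewrite -[p](addrK w); apply: le_trans (enormD _ _) _.
    by rewrite enormN lerD2r.
  apply: closedI; first exact: closed_subdifferential.
  apply: (@preimage_closed _ _ (fun p : 'rV[R]_m => enorm (p + w)) [set t | t <= B + 1]).
    by move=> q _; exact: continuous_enorm_shift.
  exact: closed_le.
- by apply: continuous_subspaceT; exact: continuous_enorm_shift.
exists p => //; rewrite -lee_fin; apply: le_trans resB.
apply: le_ereal_inf_tmp => _ [q qg <-]; rewrite lee_fin -/w.
have [qB|qB] := leP (enorm (q + w)) (B + 1); first by apply: pmin; rewrite inE.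
by apply: le_trans (ltW qB); exact: pB.
Qed.

End residual_attained.

Set Implicit Arguments.
Unset Strict Implicit.

(** * Estimates for one step *)

Section real_estimates.
Context {R : realType}.
Implicit Types a b t w z : R.

Lemma sqr_le_le a b : 0 <= b -> a ^+ 2 <= b ^+ 2 -> a <= b.
Proof.
move=> b0 H; rewrite leNgt; apply/negP => ba; move: H; apply/negP.
by rewrite -ltNge; nra.
Qed.

(** Here [w ^+ 2] is the gap at the iterate, [sa ^+ 2] the gap of [h] at the
    linearized point and [e] the linearization error.  With
    [T = (1 - th) * rho * s ^+ 2 / 2] one has [b * e <= T] and [sa <= w - T], so the
    left-hand side is at most [(w - T) * T + T ^+ 2 / 4 <= w * T]. *)
Lemma acceptance_estimate (sa b e L rho s w th : R) :
  0 <= sa -> 0 <= b -> 0 <= e -> 0 < w -> 0 <= s -> 0 <= L ->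
  e <= L / 2 * s ^+ 2 -> L * b <= (1 - th) * rho ->
  sa ^+ 2 <= w ^+ 2 - (1 - th) * (rho * w) * s ^+ 2 ->
  b * sa * e + b ^+ 2 / 4 * e ^+ 2 <= (1 - th) / 2 * (rho * w) * s ^+ 2.
Proof.
move=> sa0 b0 e0 w0 s0 L0 eL Lb saw.
pose T := (1 - th) * rho * s ^+ 2 / 2.
have beT : b * e <= T.
  have s20 := sqr_ge0 s.
  apply: (@le_trans _ _ (b * (L / 2 * s ^+ 2))); first by rewrite ler_wpM2l.
  have : L * b * s ^+ 2 <= (1 - th) * rho * s ^+ 2 by rewrite ler_wpM2r.
  rewrite /T; lra.
have be0 : 0 <= b * e by rewrite mulr_ge0.
have T0 : 0 <= T by exact: le_trans beT.
have saw' : sa ^+ 2 <= w ^+ 2 - 2 * w * T.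
  by apply: le_trans saw _; rewrite /T; lra.
have Tw : T <= w / 2.
  have : 0 <= w * (w - 2 * T) by have := sqr_ge0 sa; nra.
  by rewrite pmulr_rge0//; lra.
have saT : sa <= w - T.
  by apply: sqr_le_le; [lra|]; have := sqr_ge0 T; nra.
have -> : (1 - th) / 2 * (rho * w) * s ^+ 2 = w * T by rewrite /T; field.
have -> : b * sa * e + b ^+ 2 / 4 * e ^+ 2 = sa * (b * e) + (b * e) ^+ 2 / 4 by field.
move: (b * e) beT be0 => z zT z0.
have h1 : sa * z <= (w - T) * T.
  apply: (@le_trans _ _ ((w - T) * z)); first by rewrite ler_wpM2r.
  by rewrite ler_wpM2l//; lra.
have h2 : z ^+ 2 <= T ^+ 2 by nra.
have := sqr_ge0 T; nra.
Qed.

End real_estimates.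

Lemma add_swap_residual (V : zmodType) (a b m e : V) :
  a + e = a + (b + m) + (- m - (b - e)).
Proof. by rewrite opprB !addrA addrK addrAC addrK. Qed.

Lemma scale_residual (F : fieldType) (V : lmodType F) (mu : F) (a b e : V) :
  mu != 0 -> a + (- mu^-1 *: b) + mu^-1 *: e = mu^-1 *: (e - (b - mu *: a)).
Proof.
by move=> mu0; rewrite !scalerBr scalerA mulVf// scale1r opprB scaleNr [RHS]addrC.
Qed.

Lemma enormD_sqr (R : realType) m (a b : 'rV[R]_m) :
  enorm (a + b) ^+ 2 = enorm a ^+ 2 + enorm b ^+ 2 + 2 * dotp b a.
Proof. by rewrite -!dotpp !dotpE (dotpC a b); ring. Qed.

Lemma dist_to_ge0 (R : realType) m (x : 'rV[R]_m) A : A !=set0 -> 0 <= dist_to x A.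
Proof.
by move=> [y Ay]; apply: lb_le_inf => [|_ [z _ <-]]; [exists (enorm (y - x)), y | exact: enorm_ge0].
Qed.

(** A polynomial inequality in the distance to every point of [A] passes to the
    infimum by continuity, through points of [A] that nearly attain the distance. *)
Lemma le_horner_dist (R : realType) m (x : 'rV[R]_m) (A : set 'rV[R]_m) (P : {poly R}) (a : R) :
  A !=set0 -> (forall y : 'rV[R]_m, A y -> a <= P.[enorm (y - x)]) -> a <= P.[dist_to x A].
Proof.
move=> A0 H; rewrite leNgt; apply/negP => lt.
have eps0 : 0 < a - P.[dist_to x A] by rewrite subr_gt0.
have cP : {for dist_to x A, continuous (horner P)} by exact: continuous_horner.
move/cvgrPdist_lt: cP => /(_ _ eps0)/nbhs_ballP[e /= e0 He].
have hi : has_inf [set enorm (y - x) | y in A].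
  split; first by have [y Ay] := A0; exists (enorm (y - x)), y.
  by exists 0 => _ [y _ <-]; exact: enorm_ge0.
have [_ [y Ay <-] ylt] := inf_adherent e0 hi.
have yge : dist_to x A <= enorm (y - x) by apply: (ge_inf hi.2); exists y.
have yball : ball (dist_to x A) e (enorm (y - x)).
  by rewrite /ball/= distrC ger0_norm ?subr_ge0// ltrBlDl.
have := H y Ay; have := He _ yball; rewrite /= ltr_norml => /andP[].
by move: P.[_] P.[_] => e1 e2; lra.
Qed.

Section prox_linear.
Context {R : realType} {d n : nat}.
Variables (g : 'rV[R]_d -> \bar R) (h : 'rV[R]_n -> R) (c : 'rV[R]_d -> 'rV[R]_n).
Variables (Lh Lc gs hs theta sigma : R).
Hypothesis h_diff : forall y, differentiable h y.
Hypothesis c_diff : forall y, differentiable c y.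
Hypothesis g_gtNy : forall y, (-oo < g y)%E.
Hypothesis g_convex : convex_efun g.
Hypothesis h_convex : convex_function setT h.
Hypothesis g_lb : forall y, edom g y -> gs <= fine (g y).
Hypothesis h_lb : forall z, hs <= h z.
Hypothesis Lh_gt0 : 0 < Lh.
Hypothesis h_lip :
  forall y z, enorm (gradient h z - gradient h y) <= Lh * enorm (z - y).
Hypothesis Lc_gt0 : 0 < Lc.
Hypothesis c_lip : forall y z, edom g y -> edom g z ->
  opnorm ('J c z - 'J c y) <= Lc * enorm (z - y).
Hypothesis theta_gt0 : 0 < theta.
Hypothesis theta_lt1 : theta < 1.

Local Notation F := (Fval g h c).
Local Notation lin xk y := (c xk + (y - xk) *m 'J c xk).

Lemma fin_dom y : edom g y -> g y = (fine (g y))%:E.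
Proof. by move=> gy; rewrite fineK// fin_numElt g_gtNy. Qed.

Lemma objective_dom y : edom g y -> objective g h c y = (F y)%:E.
Proof. by move=> gy; rewrite /Fval /objective (fin_dom gy) -EFinD. Qed.

Lemma FvalE y : edom g y -> F y = fine (g y) + h (c y).
Proof. by move=> gy; rewrite /Fval /objective (fin_dom gy) -EFinD. Qed.

Lemma subdifferential_le x y p : edom g x -> edom g y ->
  subdifferential g x p -> fine (g x) + dotp p (y - x) <= fine (g y).
Proof.
by move=> gx gy /(_ y); rewrite {1}(fin_dom gx) {1}(fin_dom gy) -EFinD lee_fin.
Qed.

Lemma Fval_ge y : edom g y -> gs + hs <= F y.
Proof. by move=> gy; rewrite FvalE// lerD// g_lb. Qed.

Lemma edom_segment x w (t : R) : edom g x -> edom g (x + w) -> 0 < t -> t < 1 ->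
  edom g (x + t *: w).
Proof.
move=> gx gw t0 t1.
rewrite /edom/= segment_point; apply: le_lt_trans (g_convex _ _ (ltW t0) (ltW t1)) _.
by rewrite (fin_dom gx) (fin_dom gw) -!EFinM -EFinD ltry.
Qed.

Lemma linearization_error x y : edom g x -> edom g y ->
  enorm (c y - lin x y) <= Lc / 2 * enorm (y - x) ^+ 2.
Proof.
move=> gx gy.
have := @linearization_error_le R d n c c_diff Lc x (y - x) (ltW Lc_gt0).
rewrite [x + (y - x)]addrC subrK; apply => t t0 t1.
have gz : edom g (x + t *: (y - x)).
  by apply: edom_segment => //; rewrite addrC subrK.
have := c_lip gx gz.
by rewrite [x + _ - x]addrC addKr enormZ (ger0_norm (ltW t0)).
Qed.

Lemma gradient_h_le z : enorm (gradient h z) <= Num.sqrt (2 * Lh) * Num.sqrt (h z - hs).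
Proof.
apply: sqr_le_le; first by rewrite mulr_ge0 ?sqrtr_ge0.
rewrite exprMn [Num.sqrt (2 * Lh) ^+ 2]sqr_sqrtr ?mulr_ge0 ?(ltW Lh_gt0)//.
rewrite [Num.sqrt (h z - hs) ^+ 2]sqr_sqrtr ?subr_ge0//; exact: gradient_sqr_le.
Qed.

(** At distance [r] from [xk] the gradient of the linearized composition differs
    from that of [h \o c] by a first-order term, because the two Jacobians differ
    by [Lc * r] and are applied to a gradient of size at most
    [sqrt (2 * Lh) * sqrt (gap)], and by a second-order term, because the two
    arguments of the gradient of [h] differ by [Lc / 2 * r ^+ 2]. *)
Lemma gradient_model_error xk y : edom g xk -> edom g y ->
  opnorm ('J c xk) <= sigma ->
  enorm (gradient h (lin xk y) *m ('J c xk)^T - gradient h (c y) *m ('J c y)^T) <=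
  Lc * Num.sqrt (2 * Lh) * Num.sqrt (h (c y) - hs) * enorm (y - xk) +
  Lh * Lc * sigma / 2 * enorm (y - xk) ^+ 2.
Proof.
move=> gxk gy Js.
have JJ := c_lip gy gxk; have lerr := linearization_error gxk gy.
have gl := h_lip (c y) (lin xk y); rewrite enormB in lerr.
have gh := gradient_h_le (c y).
rewrite -[X in enorm X](subrKA (gradient h (c y) *m ('J c xk)^T)).
apply: le_trans (enormD _ _) _; rewrite addrC; apply: lerD.
  rewrite -mulmxBr -linearB; apply: le_trans (enorm_mulmx_tr_le _ _) _.
  rewrite enormB in JJ.
  apply: (@le_trans _ _ (Lc * enorm (y - xk) * (Num.sqrt (2 * Lh) * Num.sqrt (h (c y) - hs)))).
    by apply: ler_pM => //; rewrite ?opnorm_ge0 ?enorm_ge0.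
  move: (enorm _) (Num.sqrt _) (Num.sqrt _) => e a b; lra.
rewrite -mulmxBl; apply: le_trans (enorm_mulmx_tr_le _ _) _.
apply: (@le_trans _ _ (sigma * (Lh * (Lc / 2 * enorm (y - xk) ^+ 2)))).
  apply: ler_pM => //; rewrite ?opnorm_ge0 ?enorm_ge0//.
  by apply: le_trans gl _; rewrite ler_pM2l.
move: (enorm _) => e; lra.
Qed.

Lemma candidateP xk mu x : candidates g h c theta xk mu x ->
  edom g x /\ exists2 p, subdifferential g x p &
   enorm (p + (gradient h (lin xk x) *m ('J c xk)^T + mu *: (x - xk))) <=
     theta * mu * enorm (x - xk).
Proof.
move=> [gx res]; split=> //.
by have [p pg] := residual_leP g _ _ _ g_gtNy gx res; rewrite gradient_model//; exists p.
Qed.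

(** [g + h \o lin xk] is convex and this is its subgradient inequality at [x]. *)
Lemma linear_model_support xk x p y : edom g x -> edom g y ->
  subdifferential g x p ->
  fine (g x) + h (lin xk x) +
    dotp (p + gradient h (lin xk x) *m ('J c xk)^T) (y - x) <=
  fine (g y) + h (lin xk y).
Proof.
move=> gx gy px; have := subdifferential_le gx gy px.
have := @gradient_supports R n h Lh h_diff h_lip Lh_gt0 h_convex (lin xk x) ((y - x) *m 'J c xk).
have -> : lin xk x + (y - x) *m 'J c xk = lin xk y.
  by rewrite -addrA -mulmxDl [x - xk + _]addrC addrA subrK.
rewrite dotpDl dotp_mulmx trmxK.
move: (dotp p _) (dotp (gradient _ _) _) => e1 e2; lra.
Qed.

Section step.
Variables (xk x : 'rV[R]_d) (mu : R) (p : 'rV[R]_d).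
Hypothesis xk_dom : edom g xk.
Hypothesis x_dom : edom g x.
Hypothesis p_sub : subdifferential g x p.
Let v := p + (gradient h (lin xk x) *m ('J c xk)^T + mu *: (x - xk)).
Hypothesis v_le : enorm v <= theta * mu * enorm (x - xk).

Lemma model_support y : edom g y ->
  fine (g x) + h (lin xk x) + dotp (v - mu *: (x - xk)) (y - x) <=
  fine (g y) + h (lin xk y).
Proof.
move=> gy.
have -> : v - mu *: (x - xk) = p + gradient h (lin xk x) *m ('J c xk)^T.
  by rewrite /v addrA addrK.
exact: linear_model_support.
Qed.

Local Notation gap := (F xk - (gs + hs)).
Local Notation w := (Num.sqrt gap).
Local Notation s := (x - xk).

Lemma sqrt_h_gap_le y : edom g y -> F y <= F xk -> Num.sqrt (h (c y) - hs) <= w.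
Proof.
move=> gy Fle; apply: ler_wsqrtr; move: (g_lb gy) Fle; rewrite FvalE//; lra.
Qed.

(** The quadratic term of the model contributes [mu * enorm s ^+ 2]; the
    inexactness [v] costs at most the fraction [theta] of it. *)
Lemma model_decrease :
  fine (g x) + h (lin xk x) + (1 - theta) * mu * enorm s ^+ 2 <= F xk.
Proof.
have := model_support xk_dom.
rewrite subrr mul0mx addr0 -(FvalE xk_dom).
rewrite -[xk - x]opprB dotpNr dotpDl dotpNl dotpZl dotpp.
have := dotp_le v s.
have : enorm v * enorm s <= theta * mu * enorm s * enorm s.
  by rewrite ler_wpM2r// enorm_ge0.
move: (dotp _ _) (enorm s) (enorm v) (h _) (fine _) => e1 e2 e3 e4 e5; lra.
Qed.

(** Since the gradient of [h] is bounded through the gap, a penalty proportional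
    to the square root of the gap dominates the linearization error: every trial
    with [rho] above the threshold is accepted. *)
Lemma accepted_of_large_penalty rho : 0 < gap -> mu = rho * w ->
  Lc * Num.sqrt (2 * Lh) <= (1 - theta) * rho ->
  F x <= F xk - (1 - theta) / 2 * mu * enorm s ^+ 2.
Proof.
move=> gap0 muE Lrho.
have dec := model_decrease.
have lerr := linearization_error xk_dom x_dom.
have := descent_upper h Lh h_diff h_lip (lin xk x) (c x - lin xk x).
rewrite [lin xk x + _]addrC subrK.
have := dotp_le (gradient h (lin xk x)) (c x - lin xk x).
have := gradient_h_le (lin xk x); have := h_lb (lin xk x).
have := g_lb x_dom; have := enorm_ge0 (c x - lin xk x).
move: lerr dec; rewrite (FvalE x_dom).
have sw : w ^+ 2 = gap by rewrite sqr_sqrtr// ltW.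
have w0 : 0 < w by rewrite sqrtr_gt0.
have b2 : Num.sqrt (2 * Lh) ^+ 2 = 2 * Lh by rewrite sqr_sqrtr// mulr_ge0// ltW.
have b0 : 0 <= Num.sqrt (2 * Lh) by exact: sqrtr_ge0.
have s0 := enorm_ge0 s.
move: (dotp _ _) (enorm (c x - _)) (enorm (gradient _ _)) => dp e gr.
move: (h (lin xk x)) (h (c x)) (fine _) => hl hx gx.
rewrite muE; move: (F xk) (enorm s) (Num.sqrt (2 * Lh)) w Lrho sw w0 b2 b0 s0.
move=> Fk es b W Lrho sw w0 b2 b0 s0 lerr dec e0 glb hl_lb grle dple desc.
have sa2 : Num.sqrt (hl - hs) ^+ 2 = hl - hs by rewrite sqr_sqrtr// subr_ge0.
have sa0 : 0 <= Num.sqrt (hl - hs) by exact: sqrtr_ge0.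
move: (Num.sqrt (hl - hs)) sa2 sa0 grle => sa sa2 sa0 grle.
have := @acceptance_estimate R sa b e Lc rho es W theta sa0 b0 e0 w0 s0
  (ltW Lc_gt0) lerr Lrho _.
have -> : b ^+ 2 / 4 = Lh / 2 by rewrite b2; field.
have gre : gr * e <= b * sa * e by rewrite ler_wpM2r.
have h1 : sa ^+ 2 <= W ^+ 2 - (1 - theta) * (rho * W) * es ^+ 2.
  by rewrite sa2 sw; lra.
move=> /(_ h1); lra.
Qed.

(** Replace the model gradient in the candidate condition by the true one, at
    the cost of [gradient_model_error]. *)
Lemma residual_next_le rmax : opnorm ('J c xk) <= sigma ->
  F x <= F xk -> 0 <= mu -> mu <= rmax * w ->
  enorm (p + gradient (h \o c) x) <=
    ((1 + theta) * rmax + Lc * Num.sqrt (2 * Lh)) * w * enorm s +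
    Lh * Lc * sigma / 2 * enorm s ^+ 2.
Proof.
move=> Js Fle mu0 mule.
have err := gradient_model_error xk_dom x_dom Js.
have hgap := sqrt_h_gap_le x_dom Fle.
have vle := v_le.
rewrite gradient_comp//.
set G := gradient h (lin xk x) *m _ in err.
set Gx := gradient h (c x) *m _ in err *.
have -> : p + Gx = v + (- (mu *: s) - (G - Gx)).
  exact: add_swap_residual.
apply: le_trans (enormD _ _) _.
have := enormD (- (mu *: s)) (- (G - Gx)); rewrite !enormN enormZ (ger0_norm mu0).
have := enorm_ge0 s.
have L0 : 0 <= Lc * Num.sqrt (2 * Lh) by rewrite mulr_ge0 ?sqrtr_ge0 ?(ltW Lc_gt0).
move: (enorm s) (enorm v) (enorm (G - Gx)) (enorm (- _ - _)) vle err => e1 e2 e3 e4 vle err s0.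
move: w (Num.sqrt (h (c x) - hs)) (Lc * _) hgap mule err L0 => W H A hgap mule err A0.
have : mu * e1 <= rmax * W * e1 by rewrite ler_wpM2r.
have : theta * mu * e1 <= theta * (rmax * W) * e1.
  by rewrite ler_wpM2r// ler_wpM2l// ltW.
have : A * H * e1 <= A * W * e1 by rewrite ler_wpM2r// ler_wpM2l.
lra.
Qed.

(** A stationary point [y] is a zero of the gradient of the linearized problem at
    [xk] up to the error [u] of [gradient_model_error].  Monotonicity of the
    subdifferential of [g + h \o lin xk] between [x] and [y] gives the hypothesis of
    [angle_bound], applied after division by [mu]. *)
Lemma step_le_dist rmin y : opnorm ('J c xk) <= sigma -> 0 < gap ->
  0 < rmin -> rmin * w <= mu -> edom g y -> F y <= F xk ->
  subdifferential g y (- gradient (h \o c) y) ->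
  enorm s <= (Lc * Num.sqrt (2 * Lh) / ((1 - theta) * rmin) +
              1 / Num.sqrt (1 - theta ^+ 2)) * enorm (y - xk) +
    Lh * Lc * sigma / 2 / ((1 - theta) * rmin) * (enorm (y - xk) ^+ 2 / w).
Proof.
move=> Js gap0 rmin0 rminmu gy Fle.
rewrite gradient_comp// => qsub.
have err := gradient_model_error xk_dom gy Js.
have hgap := sqrt_h_gap_le gy Fle.
have w0 : 0 < w by rewrite sqrtr_gt0.
have mu0 : 0 < mu by apply: lt_le_trans rminmu; rewrite mulr_gt0.
have msup := model_support gy.
have := linear_model_support xk gy x_dom qsub.
rewrite [- _ + _]addrC.
set u := (gradient h (lin xk y) *m _ - _) in err * => lsup.
have ang : 0 <= dotp (s + (- mu^-1 *: v) + mu^-1 *: u) (y - xk - s).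
  have -> : s + (- mu^-1 *: v) + mu^-1 *: u = mu^-1 *: (u - (v - mu *: s)).
    by rewrite scale_residual// gt_eqF.
  rewrite dotpZl mulr_ge0 ?invr_ge0 ?(ltW mu0)//.
  have -> : y - xk - s = y - x by rewrite opprB addrA subrK.
  rewrite dotpDl dotpNl.
  have : dotp u (x - y) = - dotp u (y - x) by rewrite -opprB dotpNr.
  move: lsup msup; move: (dotp u (x - y)) (dotp u (y - x)) (dotp (v - _) _) => e1 e2 e3; lra.
have qle : enorm (- mu^-1 *: v) <= theta * enorm s.
  rewrite enormZ normrN ger0_norm ?invr_ge0 ?(ltW mu0)//.
  by rewrite ler_pdivrMl// mulrA [mu * _]mulrC.
apply: le_trans (angle_bound _ _ _ _ _ theta_gt0 theta_lt1 qle ang) _.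
rewrite enormZ ger0_norm ?invr_ge0 ?(ltW mu0)//.
rewrite mulrDl addrAC mul1r [_^-1 * enorm (y - xk)]mulrC lerD2r.
have t0 : 0 < 1 - theta by rewrite subr_gt0.
have := enorm_ge0 u.
have e0 := enorm_ge0 (y - xk).
have A0 : 0 <= Lc * Num.sqrt (2 * Lh) by rewrite mulr_ge0 ?sqrtr_ge0 ?(ltW Lc_gt0).
move: err hgap; move: w w0 rminmu (enorm u) (Lc * Num.sqrt _) A0 (Num.sqrt (h (c y) - hs))  (enorm (y - xk)) e0 => W W0 rmu eu A A0 H e e0 err hgap eu0.
have err' : eu <= A * W * e + Lh * Lc * sigma / 2 * e ^+ 2.
  by apply: le_trans err _; rewrite lerD2r ler_wpM2r// ler_wpM2l.
have -> : A / ((1 - theta) * rmin) * e + Lh * Lc * sigma / 2 / ((1 - theta) * rmin) * (e ^+ 2 / W) =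
   (A * W * e + Lh * Lc * sigma / 2 * e ^+ 2) / (rmin * W) / (1 - theta).
  by field; rewrite !gt_eqF.
rewrite ler_pM2r ?invr_gt0// [mu^-1 * _]mulrC.
apply: ler_pM => //; first by rewrite invr_ge0 ltW.
by rewrite lef_pV2// posrE// mulr_gt0.
Qed.

(** When the limit value is the lower bound [gs + hs], the point [y] minimizes [g]
    and [h \o c] separately, the gradient of [h] vanishes at [c y], and the linearized
    model at [y] exceeds [gs + hs] by a quartic term only.  For a small gap this is
    sharper than [step_le_dist], whose quadratic error is divided by [w]. *)
Lemma step_le_dist_zero_gap rmin y : 0 < gap ->
  0 < rmin -> rmin * w <= mu -> edom g y -> F y <= gs + hs ->
  (1 - theta ^+ 2) * enorm s ^+ 2 <= enorm (y - xk) ^+ 2 +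
    Lh * Lc ^+ 2 / 4 / rmin * (enorm (y - xk) ^+ 4 / w).
Proof.
move=> gap0 rmin0 rminmu gy Fle.
have w0 : 0 < w by rewrite sqrtr_gt0.
have mu0 : 0 < mu by apply: lt_le_trans rminmu; rewrite mulr_gt0.
have msup := model_support gy.
have [gyE hyE] : fine (g y) = gs /\ h (c y) = hs.
  by move: (g_lb gy) (h_lb (c y)) Fle; rewrite FvalE//; lra.
have gr0 : gradient h (c y) = 0.
  apply: enorm_eq0; apply/eqP; rewrite eq_le enorm_ge0 andbT.
  by apply: le_trans (gradient_h_le _) _; rewrite hyE subrr sqrtr0 mulr0.
have lerr := linearization_error xk_dom gy.
have := descent_upper h Lh h_diff h_lip (c y) (lin xk y - c y).
rewrite gr0 [c y + _]addrC subrK.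
have -> : dotp 0 (lin xk y - c y) = 0 by rewrite -(scale0r 0) dotpZl mul0r.
rewrite hyE enormB => desc.
have z2 : enorm (y - xk) ^+ 2 = enorm (y - x) ^+ 2 + enorm s ^+ 2 + 2 * dotp s (y - x).
  have -> : y - xk = (y - x) + s by rewrite addrA subrK.
  exact: enormD_sqr.
move: msup; rewrite gyE dotpDl dotpNl dotpZl.
have := dotp_ge v (y - x); have := g_lb x_dom; have := h_lb (lin xk x).
have : enorm v * enorm (y - x) <= theta * mu * enorm s * enorm (y - x).
  by rewrite ler_wpM2r// enorm_ge0.
have := enorm_ge0 (c y - lin xk y); have := enorm_ge0 (y - xk).
move: desc lerr z2 rminmu w0.
move: (enorm (c y - _)) (h (lin xk y)) (h (lin xk x)) (dotp v _) (dotp s _).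
move: (enorm (y - xk)) (enorm (y - x)) (enorm s) (enorm v) (fine _) w.
move=> D z es ev gx W e hy hx dv ds desc lerr z2 rmu W0 D0 e0 h1 h2 h3 h4 h5.
have e2 : e ^+ 2 <= (Lc / 2 * D ^+ 2) ^+ 2 by rewrite ler_sqr ?nnegrE// mulr_ge0 ?sqr_ge0// divr_ge0// ltW.
(* The inexactness term [theta * es * z] is absorbed by completing the square, at
   the price of the factor [1 - theta ^+ 2]. *)
have key : mu / 2 * ((1 - theta ^+ 2) * es ^+ 2 - D ^+ 2) <= Lh * Lc ^+ 2 / 8 * D ^+ 4.
  have : Lh / 2 * e ^+ 2 <= Lh / 2 * (Lc / 2 * D ^+ 2) ^+ 2.
    by rewrite ler_wpM2l// divr_ge0// ltW.
  have : 0 <= mu / 2 * (z - theta * es) ^+ 2 by rewrite mulr_ge0 ?sqr_ge0// divr_ge0// ltW.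
  have : mu * ds = mu * ((D ^+ 2 - z ^+ 2 - es ^+ 2) / 2) by congr (_ * _); lra.
  lra.
rewrite -lerBlDl.
have D4 : 0 <= Lh * Lc ^+ 2 / 4 * D ^+ 4.
  by rewrite !mulr_ge0 ?exprn_ge0// ?ltW// invr_ge0.
apply: (@le_trans _ _ (Lh * Lc ^+ 2 / 4 * D ^+ 4 / mu)).
  by rewrite ler_pdivlMr//; lra.
have -> : Lh * Lc ^+ 2 / 4 / rmin * (D ^+ 4 / W) = Lh * Lc ^+ 2 / 4 * D ^+ 4 / (rmin * W).
  by field; rewrite !gt_eqF.
by rewrite ler_wpM2l// lef_pV2// posrE// mulr_gt0.
Qed.

(** [h \o c] is convex up to the linearization error, on which the gradient of [h]
    acts with norm at most [sqrt (2 * Lh) * sqrt (gap)]. *)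
Lemma gap_next_le y : edom g y ->
  F x - F y <= enorm (p + gradient (h \o c) x) * enorm (y - x) +
   Lc * Num.sqrt (2 * Lh) / 2 * Num.sqrt (F x - (gs + hs)) * enorm (y - x) ^+ 2.
Proof.
move=> gy; rewrite gradient_comp//.
have gsub := subdifferential_le x_dom gy p_sub.
have lerr := linearization_error x_dom gy.
have := @gradient_supports R n h Lh h_diff h_lip Lh_gt0 h_convex (c x) (c y - c x).
rewrite [c x + _]addrC subrK.
have -> : c y - c x = (y - x) *m 'J c x + (c y - lin x y).
  by rewrite opprD [RHS]addrC addrA subrK.
rewrite dotpDr => hsup.
have := dotp_ge (gradient h (c x)) (c y - lin x y).
have hle : Num.sqrt (h (c x) - hs) <= Num.sqrt (F x - (gs + hs)).
  by apply: ler_wsqrtr; move: (g_lb x_dom); rewrite FvalE//; lra.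
have := gradient_h_le (c x).
have := dotp_ge (p + gradient h (c x) *m ('J c x)^T) (y - x).
rewrite dotpDl dotp_mulmx trmxK !FvalE//.
move: hle; rewrite FvalE// => hle.
have := enorm_ge0 (c y - lin x y); have := enorm_ge0 (gradient h (c x)).
move: gsub hsup lerr hle.
have b0 := sqrtr_ge0 (2 * Lh); have S0 := sqrtr_ge0 (fine (g x) + h (c x) - (gs + hs)).
move: (Num.sqrt (2 * Lh)) b0 (Num.sqrt (fine _ + _ - _)) S0 (Num.sqrt _) => b b0 S S0 H.
move: (dotp p _) (dotp _ (_ *m _)) (dotp _ (c y - _)) (enorm (c y - _)) (enorm (y - x)).
move: (enorm (p + _)) (enorm (gradient _ _)) (h (c x)) (h (c y)) (fine _) (fine _).
move=> e1 e2 hx hy gx gy' d1 d2 d3 e3 e4 gsub hsup lerr hle g0 e30 h1 h2 h3.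
have : e2 * e3 <= b * S * (Lc / 2 * e4 ^+ 2).
  by apply: ler_pM => //; apply: le_trans h2 _; rewrite ler_wpM2l.
lra.
Qed.

End step.

(** * Runs of the algorithm *)

Section run.
Variables (rhomin alpha : R).
Hypothesis rhomin_gt0 : 0 < rhomin.
Hypothesis alpha_gt1 : 1 < alpha.
Local Notation rhomax := (rho_max Lc Lh theta rhomin alpha).
Local Notation threshold := (Lc * Num.sqrt (2 * Lh) / (1 - theta)).

Lemma rhomin_le_max : rhomin <= rhomax.
Proof.
rewrite /rho_max; case: ltP => // lt.
have T0 : 0 < threshold by exact: lt_trans rhomin_gt0 lt.
by apply: le_trans (ltW lt) _; rewrite ler_peMl// ltW.
Qed.

(** A rejected [rho] is below the acceptance threshold, so that one multiplication
    by [alpha] cannot exceed [rho_max]. *)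
Lemma search_spec xk rho x mu rho' : edom g xk -> 0 < F xk - (gs + hs) ->
  rhomin <= rho -> rho <= rhomax ->
  search g h c theta alpha gs hs xk rho x mu rho' ->
  [/\ rhomin <= rho', rho' <= rhomax, mu = penalty g h c gs hs xk rho',
    candidates g h c theta xk mu x &
    sufficient_decrease g h c theta xk mu x].
Proof.
move=> gxk gap0 rmin rmax sr.
elim: sr rmin rmax => {rho x mu rho'} [rho x cand dec rmin rmax //|].
move=> rho x' x mu rho' cand ndec _ IH rmin rmax; apply: IH.
  by apply: le_trans rmin (ler_peMl (le_trans (ltW rhomin_gt0) rmin) (ltW alpha_gt1)).
have rholt : rho < threshold.
  rewrite ltNge; apply/negP => le; apply: ndec.
  have [gx' [p psub vle]] := candidateP cand.
  rewrite /sufficient_decrease !objective_dom// -EFinB lee_fin.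
  apply: (accepted_of_large_penalty gxk gx' psub vle gap0 erefl).
  by move: le; rewrite ler_pdivrMr ?subr_gt0// [rho * _]mulrC.
rewrite /rho_max (le_lt_trans rmin rholt).
by rewrite ler_wpM2l ?ltW// (lt_trans ltr01).
Qed.

Variables (x : nat -> 'rV[R]_d) (mu : nat -> R).
Hypothesis x_run : algorithm_run g h c theta rhomin alpha gs hs x mu.

Lemma run_spec k : edom g (x k) /\
  ((F (x k) = gs + hs /\ x k.+1 = x k) \/ [/\ 0 < F (x k) - (gs + hs),
     exists2 rho, rhomin <= rho <= rhomax & mu k = penalty g h c gs hs (x k) rho,
     candidates g h c theta (x k) (mu k) (x k.+1) &
     sufficient_decrease g h c theta (x k) (mu k) (x k.+1)]).
Proof.
have [gx0 [rho [rho0 step]]] := x_run.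
have inv j : edom g (x j) -> rhomin <= rho j <= rhomax ->
  [/\ F (x j) = gs + hs, x j.+1 = x j & rho j.+1 = rho j] \/ [/\ 0 < F (x j) - (gs + hs),
   rhomin <= rho j.+1 <= rhomax, mu j = penalty g h c gs hs (x j) (rho j.+1),
     candidates g h c theta (x j) (mu j) (x j.+1) &
     sufficient_decrease g h c theta (x j) (mu j) (x j.+1)].
  move=> gx /andP[r1 r2]; have := step j; case: eqP => [/eqP E [-> _ ->]|/eqP ne].
    by left; move: E; rewrite subr_eq0 => /eqP.
  have gap0 : 0 < F (x j) - (gs + hs) by rewrite lt_def ne subr_ge0 Fval_ge.
  by move=> /(search_spec gx gap0 r1 r2)[-> -> ->]; right.
have base j : edom g (x j) /\ rhomin <= rho j <= rhomax.
  elim: j => [|j [gx rj]]; first by rewrite rho0 lexx rhomin_le_max.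
  by have [[_ -> ->]//|[_ -> _ []]] := inv j gx rj.
have [gx rk] := base k; split => //.
have [[E -> _]|[gap0 rk1 muE cand dec]] := inv k gx rk; [by left|right].
by split => //; exists (rho k.+1).
Qed.

Lemma run_dom k : edom g (x k). Proof. by have [] := run_spec k. Qed.

Lemma run_step k : (F (x k) = gs + hs /\ x k.+1 = x k) \/ [/\ 0 < F (x k) - (gs + hs),
  [/\ rhomin * Num.sqrt (F (x k) - (gs + hs)) <= mu k,
      mu k <= rhomax * Num.sqrt (F (x k) - (gs + hs)) & 0 < mu k],
  F (x k.+1) <= F (x k) &
  exists2 p, subdifferential g (x k.+1) p &
   enorm (p + (gradient h (lin (x k) (x k.+1)) *m ('J c (x k))^T +
     mu k *: (x k.+1 - x k))) <= theta * mu k * enorm (x k.+1 - x k)].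
Proof.
have [gx [?|[gap0 [rho /andP[r1 r2] muE] cand dec]]] := run_spec k; [by left|right].
have mu0 : 0 < mu k.
  by rewrite muE mulr_gt0 ?sqrtr_gt0// (lt_le_trans rhomin_gt0).
split => //.
- by split => //; rewrite muE ler_wpM2r// sqrtr_ge0.
- move: dec; rewrite /sufficient_decrease (objective_dom (run_dom k)) (objective_dom (run_dom k.+1)) -EFinB lee_fin.
  move=> /le_trans; apply; rewrite gerBl !mulr_ge0 ?enorm_ge0 ?invr_ge0 ?(ltW mu0)//.
  by rewrite subr_ge0 ltW.
- exact: (candidateP cand).2.
Qed.

Lemma run_nincr k : F (x k.+1) <= F (x k).
Proof. by have [[_ ->]//|[]] := run_step k. Qed.

Lemma run_cvg : cvgn (fun k => F (x k)).
Proof.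
apply: nonincreasing_is_cvgn; first exact/nonincreasing_seqP/run_nincr.
by exists (gs + hs) => _ [k _ <-]; exact: Fval_ge (run_dom k).
Qed.

Local Notation Finf := (Flim g h c x).

Lemma Flim_le k : Finf <= F (x k).
Proof.
apply: nonincreasing_cvgn_ge run_cvg k; exact/nonincreasing_seqP/run_nincr.
Qed.

Lemma gap_limE : gap_lim g h c gs hs x = Finf - (gs + hs).
Proof.
rewrite /gap_lim /Flim; apply/cvg_lim => //.
by apply: cvgB; [exact: run_cvg | exact: cvg_cst].
Qed.

Lemma gap_lim_ge0 : 0 <= gap_lim g h c gs hs x.
Proof.
rewrite gap_limE subr_ge0; apply: limr_ge; first exact: run_cvg.
by apply: nearW => k; exact: Fval_ge (run_dom k).
Qed.

Lemma run_gap_small eps : 0 < eps ->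
  exists N, forall k, (N <= k)%N -> F (x k) - Finf <= eps.
Proof.
move=> eps0; have /cvgrPdist_le/(_ _ eps0)[N _ HN] := run_cvg.
exists N => k Nk; apply: le_trans (HN k Nk).
by rewrite distrC ler_norm.
Qed.

Local Notation X := (Xstar g h c x).

Lemma XstarP y : X y -> [/\ edom g y, F y <= Finf &
  subdifferential g y (- gradient (h \o c) y)].
Proof.
move=> [gy res Fle]; split => //.
  by move: Fle; rewrite objective_dom// lee_fin.
have [|p psub] := residual_leP g (h \o c) y 0 g_gtNy gy; first by rewrite res.
move=> le0; have /enorm_eq0/eqP : enorm (p + gradient (h \o c) y) = 0.
  by apply/eqP; rewrite eq_le le0 enorm_ge0.
by rewrite addr_eq0 => /eqP <-.
Qed.

Hypothesis J_bounded : forall k, opnorm ('J c (x k)) <= sigma.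
Hypothesis X_neq0 : X !=set0.

(** If the value at [x k.+1] exceeds the limit, the gap at [x k] is positive and
    iteration [k] is a genuine step. *)
Lemma run_gap_rec k : Finf < F (x k.+1) ->
  F (x k.+1) - Finf <=
   (C2 Lc Lh theta rhomin alpha * Num.sqrt (F (x k) - (gs + hs)) * enorm (x k.+1 - x k) +
    Lh * Lc * sigma / 2 * enorm (x k.+1 - x k) ^+ 2) * dist_to (x k.+1) X +
   Lc * Num.sqrt (2 * Lh) / 2 * Num.sqrt (F (x k.+1) - (gs + hs)) *
     dist_to (x k.+1) X ^+ 2.
Proof.
move=> lt; have [[E Ex]|[gap0 [mu1 mu2 mu0] Fle [p psub vle]]] := run_step k.
  by move: lt; rewrite Ex E; have := gap_lim_ge0; rewrite gap_limE; lra.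
have gk := run_dom k; have gk1 := run_dom k.+1.
have res := residual_next_le gk gk1 vle (J_bounded k) Fle (ltW mu0) mu2.
pose E := C2 Lc Lh theta rhomin alpha * Num.sqrt (F (x k) - (gs + hs)) * enorm (x k.+1 - x k) +
    Lh * Lc * sigma / 2 * enorm (x k.+1 - x k) ^+ 2.
pose A := Lc * Num.sqrt (2 * Lh) / 2 * Num.sqrt (F (x k.+1) - (gs + hs)).
have := @le_horner_dist _ _ (x k.+1) X (E%:P * 'X + A%:P * 'X^2) (F (x k.+1) - Finf) X_neq0.
have PE t : (E%:P * 'X + A%:P * 'X^2).[t] = E * t + A * t ^+ 2.
  by rewrite hornerD !hornerCM hornerX hornerXn.
rewrite PE; apply => y Xy; rewrite PE.
have [gy Fy _] := XstarP Xy.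
apply: (@le_trans _ _ (F (x k.+1) - F y)); first by rewrite lerD2l lerN2.
apply: le_trans (gap_next_le gk1 psub gy) _; rewrite lerD2r.
by apply: ler_wpM2r => //; exact: enorm_ge0.
Qed.

Lemma run_step_dist k : Finf < F (x k.+1) ->
  enorm (x k.+1 - x k) <= C1 Lc Lh theta rhomin * dist_to (x k) X +
    Lh * Lc * sigma / 2 / ((1 - theta) * rhomin) *
      (dist_to (x k) X ^+ 2 / Num.sqrt (F (x k) - (gs + hs))).
Proof.
move=> lt; have [[E Ex]|[gap0 [mu1 mu2 mu0] Fle [p psub vle]]] := run_step k.
  by move: lt; rewrite Ex E; have := gap_lim_ge0; rewrite gap_limE; lra.
have gk := run_dom k; have gk1 := run_dom k.+1.
set w := Num.sqrt _ in mu1 *; set c5 := _ / _ / _.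
have := @le_horner_dist _ _ (x k) X
  ((C1 Lc Lh theta rhomin)%:P * 'X + (c5 / w)%:P * 'X^2) (enorm (x k.+1 - x k)) X_neq0.
have PE t : ((C1 Lc Lh theta rhomin)%:P * 'X + (c5 / w)%:P * 'X^2).[t] =
    C1 Lc Lh theta rhomin * t + c5 * (t ^+ 2 / w).
  by rewrite hornerD !hornerCM hornerX hornerXn; congr (_ + _); rewrite -[LHS]mulrA [w^-1 * _]mulrC.
rewrite PE; apply => y Xy; rewrite PE.
have [gy Fy qsub] := XstarP Xy.
exact: (step_le_dist gk gk1 psub vle (J_bounded k) gap0 rhomin_gt0 mu1 gy (le_trans Fy (Flim_le k))).
Qed.

Lemma run_step_dist_zero k : gap_lim g h c gs hs x = 0 -> Finf < F (x k.+1) ->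
  (1 - theta ^+ 2) * enorm (x k.+1 - x k) ^+ 2 <= dist_to (x k) X ^+ 2 +
    Lh * Lc ^+ 2 / 4 / rhomin *
      (dist_to (x k) X ^+ 4 / Num.sqrt (F (x k) - (gs + hs))).
Proof.
rewrite gap_limE => Finf0 lt.
have [[E Ex]|[gap0 [mu1 mu2 mu0] Fle [p psub vle]]] := run_step k.
  by move: lt; rewrite Ex E; lra.
have gk := run_dom k; have gk1 := run_dom k.+1.
set w := Num.sqrt _ in mu1 *; set c6 := _ / _ / _.
have := @le_horner_dist _ _ (x k) X
  ('X^2 + (c6 / w)%:P * 'X^4) ((1 - theta ^+ 2) * enorm (x k.+1 - x k) ^+ 2) X_neq0.
have PE t : ('X^2 + (c6 / w)%:P * 'X^4).[t] = t ^+ 2 + c6 * (t ^+ 4 / w).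
  by rewrite hornerD hornerCM !hornerXn; congr (_ + _); rewrite -[LHS]mulrA [w^-1 * _]mulrC.
rewrite PE; apply => y Xy; rewrite PE.
have [gy Fy qsub] := XstarP Xy.
apply: (step_le_dist_zero_gap gk gk1 psub vle gap0 rhomin_gt0 mu1 gy).
by apply: le_trans Fy _; lra.
Qed.

End run.

End prox_linear.

(** * Rates for the scalar recursion *)

Section powR_facts.
Context {R : realType}.
Implicit Types t e : R.

Lemma powR_small (nu eps : R) : 0 < nu -> 0 < eps ->
  exists2 eta, 0 < eta & forall t, 0 <= t -> t <= eta -> t `^ nu <= eps.
Proof.
move=> nu0 eps0; exists (eps `^ nu^-1); first exact: powR_gt0.
move=> t t0 te.
have -> : eps = (eps `^ nu^-1) `^ nu by rewrite -powRrM mulVf ?gt_eqF// powRr1// ltW.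
by apply: ge0_ler_powR; rewrite ?nnegrE ?powR_ge0// ltW.
Qed.

Lemma powR_superlinear (nu M : R) : 1 < nu -> 0 <= M ->
  exists2 eta, 0 < eta & forall t, 0 < t -> t <= eta -> M * t `^ nu <= t / 2.
Proof.
move=> nu1 M0.
have nu0 : 0 < nu - 1 by rewrite subr_gt0.
have M1 : 0 < 2 * (M + 1) by lra.
have [eta eta0 H] := powR_small nu0 (divr_gt0 (@ltr01 R) M1).
exists eta => // t t0 te; have := H t (ltW t0) te.
rewrite ler_pdivlMr// => H'.
have -> : t `^ nu = t * t `^ (nu - 1).
  by rewrite mulr_powRB1// ?ltW// (lt_trans ltr01).
have p0 := powR_ge0 t (nu - 1).
have : t * (t `^ (nu - 1) * (2 * (M + 1))) <= t * 1 by rewrite ler_pM2l.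
have : 0 <= t * t `^ (nu - 1) by rewrite mulr_ge0// ltW.
lra.
Qed.

Lemma powR_anti t a b : 0 < t -> t <= 1 -> a <= b -> t `^ b <= t `^ a.
Proof. by move=> t0 t1 ab; apply: ger_powR => //; rewrite t0. Qed.

Lemma powR_exprn t a m : (t `^ a) ^+ m = t `^ (a * m%:R).
Proof. by rewrite powRrM powR_mulrn// powR_ge0. Qed.

End powR_facts.

(** [dl k] is the excess over the limit value, [D k] the distance to the stationary
    set, [s k] the step length, [Dinf] the limit gap and [q = 1 / r]. *)
Section rates.
Context {R : realType}.
Variables (dl D s : nat -> R) (Dinf q kappa c1 c2 c4 c5 c6 a2 b : R) (K : nat).
Hypothesis dl_ge0 : forall k, 0 <= dl k.
Hypothesis dl_nincr : forall k, dl k.+1 <= dl k.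
Hypothesis dl_cvg0 : forall eps, 0 < eps -> exists N, forall k, (N <= k)%N -> dl k <= eps.
Hypothesis D_ge0 : forall k, 0 <= D k.
Hypothesis s_ge0 : forall k, 0 <= s k.
Hypothesis Dinf_ge0 : 0 <= Dinf.
Hypothesis kappa_ge0 : 0 <= kappa.
Hypothesis c1_ge0 : 0 <= c1.
Hypothesis c2_ge0 : 0 <= c2.
Hypothesis c4_ge0 : 0 <= c4.
Hypothesis c5_ge0 : 0 <= c5.
Hypothesis c6_ge0 : 0 <= c6.
Hypothesis a2_ge0 : 0 <= a2.
Hypothesis b_gt0 : 0 < b.
Hypothesis gap_rec : forall k, 0 < dl k.+1 ->
  dl k.+1 <= (c2 * Num.sqrt (dl k + Dinf) * s k + c4 * s k ^+ 2) * D k.+1 +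
     a2 * Num.sqrt (dl k.+1 + Dinf) * D k.+1 ^+ 2.
Hypothesis step_dist : forall k, 0 < dl k.+1 ->
  s k <= c1 * D k + c5 * (D k ^+ 2 / Num.sqrt (dl k + Dinf)).
Hypothesis step_dist_zero : Dinf = 0 -> forall k, 0 < dl k.+1 ->
  b * s k ^+ 2 <= D k ^+ 2 + c6 * (D k ^+ 4 / Num.sqrt (dl k + Dinf)).
Hypothesis D_le : forall k, (K <= k)%N -> D k <= kappa * dl k `^ q.

Definition recursion (B e : R) (k : nat) :=
  0 < dl k.+1 -> dl k.+1 <= B * dl k `^ e * dl k.+1 `^ q.

(** The term of order [nu > 1] in [dl k.+1] is eventually absorbed by half of the
    left-hand side. *)
Lemma eventually_recursion e (M Mu a nu : R) :
  0 <= M -> 0 <= Mu -> 1 < nu ->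
  (forall k, (K <= k)%N -> 0 < dl k.+1 -> dl k <= 1 ->
    [/\ c2 * Num.sqrt (dl k + Dinf) * s k + c4 * s k ^+ 2 <= M * dl k `^ e &
       a2 * Num.sqrt (dl k.+1 + Dinf) * D k.+1 ^+ 2 <= Mu * dl k.+1 `^ nu]) ->
  exists2 B, 0 <= B & exists N, forall k, (N <= k)%N -> recursion B e k.
Proof.
move=> M0 Mu0 nu1 H.
have [eta eta0 small] := powR_superlinear nu1 Mu0.
have m0 : 0 < Num.min 1 eta by rewrite lt_min ltr01.
have [N HN] := dl_cvg0 m0.
exists (2 * M * kappa); first by rewrite !mulr_ge0.
exists (maxn N K) => k; rewrite geq_max => /andP[Nk Kk] u0.
have := HN k Nk; rewrite le_min => /andP[t1 teta].
have [h1 h2] := H k Kk u0 t1.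
have h3 := small _ u0 (le_trans (dl_nincr k) teta).
have h4 := D_le (leqW Kk).
have := gap_rec u0.
have h5 : (c2 * Num.sqrt (dl k + Dinf) * s k + c4 * s k ^+ 2) * D k.+1 <=
  M * dl k `^ e * (kappa * dl k.+1 `^ q).
  apply: ler_pM => //.
  by rewrite addr_ge0 ?mulr_ge0 ?sqrtr_ge0 ?exprn_ge0.
lra.
Qed.

(** With [Dinf = 0] both the step and the distance are [O(dl `^ q)]: the quartic
    error contributes [dl `^ (4 * q - 2^-1)], which is smaller because [q > 4^-1].
    The two terms of [gap_rec] then have orders [2^-1 + q] and [2 * q], and the last
    term has order [2^-1 + 2 * q > 1]. *)
Lemma recursion_zero_gap e : Dinf = 0 -> 4^-1 < q -> e <= 2^-1 + q -> e <= 2 * q ->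
  exists2 B, 0 <= B & exists N, forall k, (N <= k)%N -> recursion B e k.
Proof.
move=> Dinf0 q4 e1 e2.
pose M2 := (kappa ^+ 2 + c6 * kappa ^+ 4) / b.
have M20 : 0 <= M2 by rewrite divr_ge0 ?(ltW b_gt0)// addr_ge0 ?mulr_ge0 ?exprn_ge0.
pose M := Num.sqrt M2.
have M0 : 0 <= M by exact: sqrtr_ge0.
apply: (@eventually_recursion e (c2 * M + c4 * M ^+ 2) (a2 * kappa ^+ 2) 0 (2^-1 + 2 * q)).
- by rewrite addr_ge0 ?mulr_ge0 ?exprn_ge0.
- by rewrite mulr_ge0 ?exprn_ge0.
- lra.
move=> k Kk u0 t1.
have t0 : 0 < dl k by apply: lt_le_trans (dl_nincr k).
have sM : s k <= M * dl k `^ q.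
  have Dk := D_le Kk.
  rewrite -ler_sqr ?nnegrE ?mulr_ge0 ?powR_ge0//.
  rewrite exprMn powR_exprn /M sqr_sqrtr// /M2 mulrAC ler_pdivlMr// mulrC.
  apply: le_trans (step_dist_zero Dinf0 u0) _.
  rewrite Dinf0 addr0.
  have D2 : D k ^+ 2 <= kappa ^+ 2 * dl k `^ (q * 2).
    by rewrite -powR_exprn -exprMn ler_sqr ?nnegrE ?mulr_ge0 ?powR_ge0.
  have D4 : D k ^+ 4 <= kappa ^+ 4 * dl k `^ (q * 4).
    by rewrite -powR_exprn -exprMn lerXn2r ?nnegrE ?mulr_ge0 ?powR_ge0.
  rewrite mulrDl; apply: lerD => //; rewrite -[leRHS]mulrA ler_wpM2l//.
  rewrite ler_pdivrMr ?sqrtr_gt0//; apply: le_trans D4 _.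
  rewrite -[leRHS]mulrA ler_wpM2l ?exprn_ge0// -powR12_sqrt ?(ltW t0)// -powRD; last first.
    by apply/implyP => _; rewrite gt_eqF.
  by apply: powR_anti => //; lra.
split.
  rewrite Dinf0 addr0 mulrDl; apply: lerD.
    have -> : c2 * Num.sqrt (dl k) * s k = c2 * (Num.sqrt (dl k) * s k) by rewrite mulrA.
    rewrite -!mulrA ler_wpM2l//.
    apply: (@le_trans _ _ (Num.sqrt (dl k) * (M * dl k `^ q))).
      by rewrite ler_wpM2l// sqrtr_ge0.
    rewrite mulrCA ler_wpM2l// -powR12_sqrt ?(ltW t0)// -powRD; last first.
      by apply/implyP => _; rewrite gt_eqF.
    exact: powR_anti.
  rewrite -mulrA ler_wpM2l//.
  apply: (@le_trans _ _ ((M * dl k `^ q) ^+ 2)).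
    by rewrite ler_sqr ?nnegrE ?mulr_ge0 ?powR_ge0.
  rewrite exprMn powR_exprn ler_wpM2l ?exprn_ge0//.
  by apply: powR_anti => //; lra.
rewrite Dinf0 addr0 -[leLHS]mulrA -[leRHS]mulrA ler_wpM2l//.
rewrite powRD; last by apply/implyP => _; rewrite gt_eqF.
rewrite powR12_sqrt ?(ltW u0)// [leRHS]mulrCA ler_wpM2l ?sqrtr_ge0//.
rewrite [2 * q]mulrC -powR_exprn -exprMn.
by rewrite ler_sqr ?nnegrE ?mulr_ge0 ?powR_ge0// D_le// leqW.
Qed.

(** With [Dinf > 0] the square roots stay between positive constants, the first
    term of [gap_rec] has order [q], and the last one has order [2 * q > 1]. *)
Lemma recursion_pos_gap : 0 < Dinf -> 2^-1 < q ->
  exists2 B, 0 <= B & exists N, forall k, (N <= k)%N -> recursion B q k.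
Proof.
move=> Dinf0 q2.
pose W := Num.sqrt (1 + Dinf); pose w := Num.sqrt Dinf.
have w0 : 0 < w by rewrite sqrtr_gt0.
have W0 : 0 <= W by exact: sqrtr_ge0.
pose M := c1 * kappa + c5 * (kappa ^+ 2 / w).
have M0 : 0 <= M by rewrite addr_ge0 ?mulr_ge0 ?exprn_ge0// invr_ge0 ltW.
apply: (@eventually_recursion q (c2 * W * M + c4 * M ^+ 2) (a2 * W * kappa ^+ 2) 0 (2 * q)).
- by rewrite addr_ge0 ?mulr_ge0 ?exprn_ge0.
- by rewrite !mulr_ge0 ?exprn_ge0.
- lra.
move=> k Kk u0 t1.
have t0 : 0 < dl k by apply: lt_le_trans (dl_nincr k).
have p0 := powR_ge0 (dl k) q.
have p2 : dl k `^ q ^+ 2 <= dl k `^ q by rewrite powR_exprn; apply: powR_anti => //; lra.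
have Dk := D_le Kk.
have WW t : t <= 1 -> Num.sqrt (t + Dinf) <= W by move=> ?; apply: ler_wsqrtr; rewrite lerD2r.
have sM : s k <= M * dl k `^ q.
  apply: le_trans (step_dist u0) _; rewrite /M mulrDl; apply: lerD.
    by rewrite -mulrA ler_wpM2l.
  rewrite -mulrA ler_wpM2l// [leRHS]mulrAC; apply: ler_pM; rewrite ?exprn_ge0 ?invr_ge0 ?sqrtr_ge0//.
    apply: (@le_trans _ _ ((kappa * dl k `^ q) ^+ 2)).
      by rewrite ler_sqr ?nnegrE ?mulr_ge0.
    by rewrite exprMn ler_wpM2l ?exprn_ge0.
  rewrite lef_pV2 ?posrE ?sqrtr_gt0 ?addr_gt0//.
  by apply: ler_wsqrtr; rewrite lerDr ltW.
split.
  rewrite mulrDl; apply: lerD.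
    rewrite -!mulrA ler_wpM2l//; apply: ler_pM; rewrite ?sqrtr_ge0//; exact: WW.
  rewrite -mulrA ler_wpM2l//.
  apply: (@le_trans _ _ ((M * dl k `^ q) ^+ 2)).
    by rewrite ler_sqr ?nnegrE ?mulr_ge0.
  by rewrite exprMn ler_wpM2l ?exprn_ge0.
rewrite -[leLHS]mulrA -[leRHS]mulrA -[leRHS]mulrA ler_wpM2l//.
apply: ler_pM; rewrite ?sqrtr_ge0 ?exprn_ge0//.
  by apply: WW; apply: le_trans t1.
rewrite [2 * q]mulrC -powR_exprn -exprMn.
by rewrite ler_sqr ?nnegrE ?mulr_ge0 ?powR_ge0// D_le// leqW.
Qed.

(** Divide by [dl k.+1 `^ q] and take the power [1 / (1 - q)]. *)
Lemma order_of_recursion B e : q < 1 -> 0 <= B ->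
  (exists N, forall k, (N <= k)%N -> recursion B e k) -> e / (1 - q) != 1 ->
  exists (C : R) (k0 : nat), [/\ 0 <= C, e / (1 - q) = 1 -> C < 1 &
    forall k, (k0 <= k)%N -> dl k.+1 <= C * dl k `^ (e / (1 - q))].
Proof.
move=> q1 B0 [N HN] p1; exists (B `^ (1 - q)^-1), N; split.
- exact: powR_ge0.
- by move=> /eqP; rewrite (negbTE p1).
move=> k Nk.
have [u0|u0] := leP (dl k.+1) 0.
  by apply: le_trans u0 _; rewrite mulr_ge0 ?powR_ge0.
have t0 : 0 < dl k by apply: lt_le_trans (dl_nincr k).
have q0 : 0 < 1 - q by rewrite subr_gt0.
have H := HN k Nk u0.
have H' : dl k.+1 `^ (1 - q) <= B * dl k `^ e.
  rewrite powRB ?u0//; last by apply/implyP => _; rewrite gt_eqF.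
  by rewrite powRr1 ?(ltW u0)// ler_pdivrMr ?powR_gt0.
rewrite [dl k `^ _]powRrM -powRM ?powR_ge0//.
have -> : dl k.+1 = (dl k.+1 `^ (1 - q)) `^ (1 - q)^-1.
  by rewrite -powRrM mulfV ?gt_eqF// powRr1// ltW.
by apply: ge0_ler_powR; rewrite ?nnegrE ?powR_ge0 ?invr_ge0 ?(ltW q0)// mulr_ge0 ?powR_ge0.
Qed.

(** Dividing by [dl k.+1] would give [1 <= B * dl k `^ e], whose right-hand side
    tends to 0. *)
Lemma finite_of_recursion B e : q = 1 -> 0 <= B -> 0 < e ->
  (exists N, forall k, (N <= k)%N -> recursion B e k) -> exists k, dl k = 0.
Proof.
move=> q1 B0 e0 [N HN].
have [eta eta0 small] := powR_small e0 (divr_gt0 (@ltr01 R) (ltr_wpDl B0 (@ltr01 R))).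
have [N' HN'] := dl_cvg0 eta0.
pose k := maxn N N'.
exists k.+1; apply/eqP; rewrite eq_le dl_ge0 andbT leNgt; apply/negP => u0.
have := HN k (leq_maxl _ _) u0; rewrite q1 powRr1 ?(ltW u0)//.
have := small _ (dl_ge0 k) (HN' k (leq_maxr _ _)).
have B1 : 0 < B + 1 by exact: ltr_wpDl.
rewrite ler_pdivlMr// => h; rewrite -[leLHS]mul1r ler_pM2r// => h'.
have := powR_ge0 (dl k) e => p0.
have : 0 < dl k `^ e by rewrite lt_def p0 andbT; apply/eqP => E; move: h'; rewrite E; lra.
lra.
Qed.

(** For [q = 2^-1] put [x = sqrt (dl k)] and [y = sqrt (dl k.+1)].  The recursion
    becomes [y ^+ 2 <= P * x * y + P' * y ^+ 2], where [P] and [P'] tend to the two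
    quantities that are assumed to be less than [2^-1] and [4^-1].  Eventually
    [y <= 2 / 3 * x]. *)
Lemma linear_rate : q = 2^-1 -> 0 < Dinf ->
  c1 * c2 * kappa ^+ 2 * Num.sqrt Dinf < 2^-1 ->
  a2 * kappa ^+ 2 * Num.sqrt Dinf < 4^-1 ->
  exists (C : R) (k0 : nat), [/\ 0 <= C, C < 1 &
    forall k, (k0 <= k)%N -> dl k.+1 <= C * dl k].
Proof.
move=> q2 Dinf0 lt1 lt2.
set w := Num.sqrt Dinf in lt1 lt2.
have w0 : 0 < w by rewrite sqrtr_gt0.
pose m := c5 * kappa ^+ 2 / w; pose n1 := c1 * kappa.
have m0 : 0 <= m by rewrite divr_ge0 ?mulr_ge0 ?exprn_ge0// ltW.
have n10 : 0 <= n1 by rewrite mulr_ge0.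
pose Q := kappa * (c2 * (w * m + n1 + m) + c4 * (n1 + m) ^+ 2).
have Q0 : 0 <= Q.
  by rewrite mulr_ge0// addr_ge0// mulr_ge0 ?exprn_ge0 ?addr_ge0// mulr_ge0// ltW.
pose A := a2 * kappa ^+ 2.
have A0 : 0 <= A by rewrite mulr_ge0 ?exprn_ge0.
(* For [x <= 1] the coefficient [P] exceeds its limit by at most [Q * x], and [P']
   by [A * x]. *)
pose eta := Num.min 1 (Num.min ((2^-1 - c1 * c2 * kappa ^+ 2 * w) / (Q + 1))
  ((4^-1 - A * w) / (A + 1))).
have Q1 : 0 < Q + 1 by exact: ltr_wpDl.
have A1 : 0 < A + 1 by exact: ltr_wpDl.
have eta0 : 0 < eta by rewrite !lt_min ltr01 !divr_gt0 ?subr_gt0.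
have [N HN] := dl_cvg0 (exprn_gt0 2 eta0).
exists (4 / 9), (maxn N K); split; [lra|lra|].
move=> k; rewrite geq_max => /andP[Nk Kk].
have [u0|u0] := leP (dl k.+1) 0; first by have := dl_ge0 k; lra.
have t0 : 0 < dl k by apply: lt_le_trans (dl_nincr k).
pose x := Num.sqrt (dl k); pose y := Num.sqrt (dl k.+1).
have x0 : 0 < x by rewrite sqrtr_gt0.
have y0 : 0 < y by rewrite sqrtr_gt0.
have x2 : x ^+ 2 = dl k by rewrite sqr_sqrtr.
have y2 : y ^+ 2 = dl k.+1 by rewrite sqr_sqrtr.
have yx : y <= x by exact: ler_wsqrtr.
have : x <= eta.
  by rewrite -ler_sqr ?nnegrE ?(ltW x0) ?(ltW eta0)// x2 HN.
rewrite !le_min !ler_pdivlMr// => /and3P[x1 xQ xA].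
have Wx : Num.sqrt (dl k + Dinf) <= w + x.
  rewrite -ler_sqr ?nnegrE ?sqrtr_ge0 ?addr_ge0 ?sqrtr_ge0//.
  rewrite sqr_sqrtr ?addr_ge0// sqrrD x2 /w sqr_sqrtr//.
  have : 0 <= w * x by rewrite mulr_ge0// ltW.
  rewrite /w; lra.
have Wy : Num.sqrt (dl k.+1 + Dinf) <= w + x.
  by apply: le_trans Wx; apply: ler_wsqrtr; rewrite lerD2r.
have wW : w <= Num.sqrt (dl k + Dinf) by apply: ler_wsqrtr; rewrite lerDr.
have Dk : D k <= kappa * x by have := D_le Kk; rewrite q2 powR12_sqrt.
have Dk1 : D k.+1 <= kappa * y.
  by have := D_le (leqW Kk); rewrite q2 powR12_sqrt.
have sk : s k <= (n1 + m * x) * x.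
  apply: le_trans (step_dist u0) _; rewrite mulrDl; apply: lerD.
    by rewrite /n1 -mulrA ler_wpM2l.
  have -> : m * x * x = c5 * ((kappa * x) ^+ 2 / w) by rewrite /m; field; rewrite gt_eqF.
  rewrite ler_wpM2l//; apply: ler_pM; rewrite ?exprn_ge0 ?invr_ge0 ?sqrtr_ge0//.
    by rewrite ler_sqr ?nnegrE ?mulr_ge0// ltW.
  by rewrite lef_pV2 ?posrE// (lt_le_trans w0).
pose z := n1 + m * x.
have z0 : 0 <= z by exact: addr_ge0 n10 (mulr_ge0 m0 (ltW x0)).
have zm : z <= n1 + m by rewrite lerD2l -[leRHS]mulr1 ler_wpM2l.
have sk2 : s k ^+ 2 <= (z * x) ^+ 2 by rewrite ler_sqr ?nnegrE ?mulr_ge0 ?(ltW x0).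
have first : c2 * Num.sqrt (dl k + Dinf) * s k + c4 * s k ^+ 2 <=
    (c2 * (w + x) * z + c4 * x * z ^+ 2) * x.
  rewrite mulrDl; apply: lerD.
    rewrite -!mulrA ler_wpM2l//; apply: ler_pM; rewrite ?sqrtr_ge0//.
  by apply: le_trans (ler_wpM2l c4_ge0 sk2) _; lra.
have Ple : kappa * (c2 * (w + x) * z + c4 * x * z ^+ 2) <=
    c1 * c2 * kappa ^+ 2 * w + Q * x.
  have h1 : (w + x) * z <= w * n1 + x * (w * m + n1 + m).
    have : 0 <= m * x * (1 - x).
      by apply: mulr_ge0; [exact: mulr_ge0 m0 (ltW x0) | rewrite subr_ge0].
    rewrite /z; lra.
  have h2 : z ^+ 2 <= (n1 + m) ^+ 2 by apply: lerXn2r => //; rewrite nnegrE // ; exact: addr_ge0.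
  have h3 : c2 * ((w + x) * z) <= c2 * (w * n1 + x * (w * m + n1 + m)) by rewrite ler_wpM2l.
  have h4 : c4 * x * z ^+ 2 <= c4 * x * (n1 + m) ^+ 2 by rewrite ler_wpM2l// mulr_ge0// ltW.
  have h5 : kappa * (c2 * ((w + x) * z) + c4 * x * z ^+ 2) <=
     kappa * (c2 * (w * n1 + x * (w * m + n1 + m)) + c4 * x * (n1 + m) ^+ 2).
    by rewrite ler_wpM2l// lerD.
  move: h5; rewrite /Q /n1; lra.
have P2 : kappa * (c2 * (w + x) * z + c4 * x * z ^+ 2) <= 2^-1.
  by apply: le_trans Ple _; lra.
have := gap_rec u0.
have g1 : (c2 * Num.sqrt (dl k + Dinf) * s k + c4 * s k ^+ 2) * D k.+1 <=
   (c2 * (w + x) * z + c4 * x * z ^+ 2) * x * (kappa * y).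
  apply: ler_pM => //; by rewrite addr_ge0 ?mulr_ge0 ?sqrtr_ge0 ?exprn_ge0.
have g2 : a2 * Num.sqrt (dl k.+1 + Dinf) * D k.+1 ^+ 2 <= a2 * (w + x) * (kappa * y) ^+ 2.
  apply: ler_pM; rewrite ?mulr_ge0 ?sqrtr_ge0 ?exprn_ge0//.
    by rewrite ler_wpM2l.
  by rewrite ler_sqr ?nnegrE ?mulr_ge0// ltW.
have g3 : A * (w + x) <= 4^-1 by lra.
have g4 : A * (w + x) * y ^+ 2 <= 4^-1 * y ^+ 2 by rewrite ler_wpM2r ?exprn_ge0// ltW.
have g5 : kappa * (c2 * (w + x) * z + c4 * x * z ^+ 2) * (x * y) <= 2^-1 * (x * y).
  by rewrite ler_wpM2r// mulr_ge0// ltW.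
move=> g6; have := le_trans g6 (lerD g1 g2); rewrite -{1}y2 => {}g6.
rewrite -y2 -x2.
have : y * (3 * y) <= y * (2 * x) by move: g4 g5 g6; rewrite /A; move: (c2 * _ * _ + _) => P; lra.
rewrite ler_pM2l// => g7.
have : (3 * y) ^+ 2 <= (2 * x) ^+ 2 by rewrite ler_sqr ?nnegrE ?mulr_ge0// ltW.
rewrite !exprMn; lra.
Qed.

End rates.

(** * Constants and conclusion *)

Section constants.
Context {R : realType}.
Variables (Lc Lh theta rhomin alpha : R).
Hypothesis Lh_gt0 : 0 < Lh.
Hypothesis Lc_gt0 : 0 < Lc.
Hypothesis theta_gt0 : 0 < theta.
Hypothesis theta_lt1 : theta < 1.
Hypothesis rhomin_gt0 : 0 < rhomin.
Hypothesis alpha_gt1 : 1 < alpha.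
Local Notation A := (Lc * Num.sqrt (2 * Lh)).

Lemma A_gt0 : 0 < A.
Proof. by rewrite mulr_gt0// sqrtr_gt0 mulr_gt0. Qed.

Lemma rho_max_ge : A <= rho_max Lc Lh theta rhomin alpha.
Proof.
have t0 : 0 < 1 - theta by rewrite subr_gt0.
have AT : A <= A / (1 - theta).
  by rewrite ler_pdivlMr// ler_piMr ?(ltW A_gt0)// gerBl ltW.
rewrite /rho_max; case: ltP => [_|T]; last exact: le_trans AT T.
apply: le_trans AT _; rewrite ler_peMl ?(ltW alpha_gt1)//.
by rewrite divr_ge0 ?(ltW A_gt0) ?(ltW t0).
Qed.

Lemma C1_ge1 : 1 <= C1 Lc Lh theta rhomin.
Proof.
have t0 : 0 < 1 - theta by rewrite subr_gt0.
have t2 : 0 < 1 - theta ^+ 2 by rewrite subr_gt0 expr_lt1 ?(ltW theta_gt0).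
rewrite /C1; apply: ler_wpDl.
  by rewrite divr_ge0 ?(ltW A_gt0) ?mulr_ge0 ?(ltW t0) ?(ltW rhomin_gt0).
rewrite ler_pdivlMr ?sqrtr_gt0// mul1r -[leRHS]sqrtr1; apply: ler_wsqrtr.
by rewrite gerBl sqr_ge0.
Qed.

Lemma C2_ge : 2 * A <= C2 Lc Lh theta rhomin alpha.
Proof.
rewrite /C2 -[2 * A]/((1 + 1) * A) mulrDl mul1r lerD2r.
have r0 := le_trans (ltW A_gt0) rho_max_ge.
by apply: le_trans rho_max_ge _; rewrite ler_peMl// lerDl ltW.
Qed.

End constants.

Lemma growth_root (R : realType) (r gamma D e : R) : 0 < r -> 0 < gamma ->
  0 <= D -> gamma / r * D `^ r <= e -> D <= (r / gamma) `^ r^-1 * e `^ r^-1.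
Proof.
move=> r0 gamma0 D0 H.
have rg : 0 < r / gamma by rewrite divr_gt0.
have e0 : 0 <= e by apply: le_trans H; rewrite mulr_ge0 ?powR_ge0// divr_ge0 ?ltW.
have H' : D `^ r <= r / gamma * e.
  by rewrite -ler_pdivrMl// invf_div.
rewrite -powRM ?(ltW rg)//.
have -> : D = (D `^ r) `^ r^-1 by rewrite -powRrM mulfV ?gt_eqF// powRr1.
apply: ge0_ler_powR => //; rewrite ?nnegrE ?powR_ge0//.
  by rewrite invr_ge0 ltW.
exact: mulr_ge0 (ltW rg) e0.
Qed.

Unset Implicit Arguments.

Theorem theorem2 (R : realType) (d n : nat)
  (g : 'rV[R]_d -> \bar R) (h : 'rV[R]_n -> R) (c : 'rV[R]_d -> 'rV[R]_n)
  (Lh Lc gs hs theta rhomin alpha sigma r gamma : R)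
  (x : nat -> 'rV[R]_d) (mu : nat -> R) (K : nat)
  (h_diff : forall y, differentiable h y)
  (c_diff : forall y, differentiable c y)
  (c_C1 : continuous (fun y => 'J c y))
  (A1_proper : proper_efun g)
  (A1_closed : lower_semicontinuous g)
  (A1_convex : convex_efun g)
  (A2 : convex_function setT h)
  (A3 : (-oo < ereal_inf (range g))%E)
  (A4 : (-oo < ereal_inf (range (EFin \o h)))%E)
  (Lh_gt0 : 0 < Lh)
  (A5 : forall y z, enorm (gradient h z - gradient h y) <= Lh * enorm (z - y))
  (Lc_gt0 : 0 < Lc)
  (A6 : forall y z, edom g y -> edom g z ->
     opnorm ('J c z - 'J c y) <= Lc * enorm (z - y))
  (gs_le : (gs%:E <= ereal_inf (range g))%E)
  (hs_le : (hs%:E <= ereal_inf (range (EFin \o h)))%E)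
  (theta_gt0 : 0 < theta) (theta_lt1 : theta < 1)
  (rhomin_gt0 : 0 < rhomin)
  (alpha_gt1 : 1 < alpha)
  (x_run : algorithm_run g h c theta rhomin alpha gs hs x mu)
  (sigma_gt0 : 0 < sigma)
  (Jc_bounded : forall k, opnorm ('J c (x k)) <= sigma)
  (Xstar_neq0 : Xstar g h c x !=set0)
  (r_ge1 : 1 <= r) (r_lt3 : r < 3)
  (gamma_gt0 : 0 < gamma)
  (growth : forall k, (K <= k)%N ->
     gamma / r * dist_to (x k) (Xstar g h c x) `^ r
       <= Fval g h c (x k) - Flim g h c x) :
  let F k := Fval g h c (x k) in
  let Finf := Flim g h c x in
  let Dinf := gap_lim g h c gs hs x in
  [/\ r = 1 -> exists k : nat, objective g h c (x k) = Finf%:E,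
      1 < r -> r < 2 -> Dinf = 0 ->
        converges_with_order F Finf ((r + 2) / (2 * (r - 1))),
      1 < r -> r < 2 -> 0 < Dinf ->
        converges_with_order F Finf (1 / (r - 1)),
      2 <= r -> r < 3 -> Dinf = 0 ->
        converges_with_order F Finf (2 / (r - 1)) &
      r = 2 -> 0 < Dinf ->
        Dinf < 1 / C3 Lc Lh theta rhomin alpha r gamma ^+ 2 ->
        converges_with_order F Finf 1].
Proof.
move=> F Finf Dinf.
have gN y : (-oo < g y)%E by exact: A1_proper.1.
have glb y : edom g y -> gs <= fine (g y).
  move=> gy; rewrite -lee_fin -(fin_dom gN gy).
  by apply: le_trans gs_le _; apply: ereal_inf_lbound; exists y.
have hlb z : hs <= h z.
  rewrite -lee_fin; apply: le_trans hs_le _; apply: ereal_inf_lbound; by exists z.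
have dom := run_dom h_diff c_diff gN A1_convex A2 glb hlb Lh_gt0 A5 Lc_gt0 A6
  theta_lt1 rhomin_gt0 alpha_gt1 x_run.
have nincr := run_nincr h_diff c_diff gN A1_convex A2 glb hlb Lh_gt0 A5 Lc_gt0 A6
  theta_lt1 rhomin_gt0 alpha_gt1 x_run.
have Fle := Flim_le h_diff c_diff gN A1_convex A2 glb hlb Lh_gt0 A5 Lc_gt0 A6
  theta_lt1 rhomin_gt0 alpha_gt1 x_run.
have small := run_gap_small h_diff c_diff gN A1_convex A2 glb hlb Lh_gt0 A5 Lc_gt0 A6
  theta_lt1 rhomin_gt0 alpha_gt1 x_run.
have DinfE := gap_limE h_diff c_diff gN A1_convex A2 glb hlb Lh_gt0 A5 Lc_gt0 A6
  theta_lt1 rhomin_gt0 alpha_gt1 x_run.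
have Dinf0 := gap_lim_ge0 h_diff c_diff gN A1_convex A2 glb hlb Lh_gt0 A5 Lc_gt0 A6
  theta_lt1 rhomin_gt0 alpha_gt1 x_run.
have run_rec := run_gap_rec h_diff c_diff gN A1_convex A2 glb hlb Lh_gt0 A5 Lc_gt0 A6
  theta_gt0 theta_lt1 rhomin_gt0 alpha_gt1 x_run Jc_bounded Xstar_neq0.
have run_dist := run_step_dist h_diff c_diff gN A1_convex A2 glb hlb Lh_gt0 A5 Lc_gt0 A6
  theta_gt0 theta_lt1 rhomin_gt0 alpha_gt1 x_run Jc_bounded Xstar_neq0.
have run_dist_zero := run_step_dist_zero h_diff c_diff gN A1_convex A2 glb hlb Lh_gt0 A5 Lc_gt0 A6
  theta_lt1 rhomin_gt0 alpha_gt1 x_run Xstar_neq0.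
rewrite -/Finf in Fle small DinfE run_rec run_dist run_dist_zero growth.
rewrite -/Dinf in DinfE Dinf0 run_dist_zero.
pose dl k := F k - Finf.
pose D k := dist_to (x k) (Xstar g h c x).
pose s k := enorm (x k.+1 - x k).
have dlE k : dl k + Dinf = Fval g h c (x k) - (gs + hs).
  by rewrite /dl DinfE addrA subrK.
have dl_ge0 k : 0 <= dl k by rewrite /dl subr_ge0; exact: Fle.
have dl_nincr k : dl k.+1 <= dl k by rewrite /dl lerD2r; exact: nincr.
have D_ge0 k : 0 <= D k by exact: dist_to_ge0.
have s_ge0 k : 0 <= s k by exact: enorm_ge0.
have t0 : 0 < 1 - theta by rewrite subr_gt0.
have t2 : 0 < 1 - theta ^+ 2 by rewrite subr_gt0 expr_lt1 ?(ltW theta_gt0).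
pose c1 := C1 Lc Lh theta rhomin; pose c2 := C2 Lc Lh theta rhomin alpha.
pose a2 := Lc * Num.sqrt (2 * Lh) / 2.
have A0 := A_gt0 Lh_gt0 Lc_gt0.
have c1_1 : 1 <= c1 by exact: C1_ge1.
have c2_A : 2 * (Lc * Num.sqrt (2 * Lh)) <= c2 by exact: C2_ge.
have c1_0 : 0 <= c1 by exact: le_trans c1_1.
have c2_0 : 0 <= c2 by apply: le_trans c2_A; rewrite mulr_ge0// ltW.
pose c4 := Lh * Lc * sigma / 2; pose c5 := c4 / ((1 - theta) * rhomin).
pose c6 := Lh * Lc ^+ 2 / 4 / rhomin.
have c4_0 : 0 <= c4 by rewrite /c4 !mulr_ge0 ?invr_ge0// ltW.
have c5_0 : 0 <= c5 by rewrite /c5 mulr_ge0// invr_ge0 mulr_ge0 ?ltW.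
have c6_0 : 0 <= c6 by rewrite /c6 !mulr_ge0 ?invr_ge0// ltW.
have a2_0 : 0 <= a2 by rewrite /a2 mulr_ge0 ?invr_ge0// ltW.
have r0 : 0 < r by exact: lt_le_trans r_ge1.
pose kappa := (r / gamma) `^ r^-1.
have kappa0 : 0 <= kappa by exact: powR_ge0.
have D_le k : (K <= k)%N -> D k <= kappa * dl k `^ r^-1.
  by move=> Kk; apply: growth_root => //; exact: growth.
have gap_rec k : 0 < dl k.+1 -> dl k.+1 <=
    (c2 * Num.sqrt (dl k + Dinf) * s k + c4 * s k ^+ 2) * D k.+1 +
     a2 * Num.sqrt (dl k.+1 + Dinf) * D k.+1 ^+ 2.
  by move=> u0; rewrite !dlE; apply: run_rec; rewrite -subr_gt0.
have step_dist k : 0 < dl k.+1 ->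
    s k <= c1 * D k + c5 * (D k ^+ 2 / Num.sqrt (dl k + Dinf)).
  by move=> u0; rewrite !dlE; apply: run_dist; rewrite -subr_gt0.
have step_dist_zero : Dinf = 0 -> forall k, 0 < dl k.+1 ->
    (1 - theta ^+ 2) * s k ^+ 2 <= D k ^+ 2 + c6 * (D k ^+ 4 / Num.sqrt (dl k + Dinf)).
  by move=> D00 k u0; rewrite !dlE; apply: run_dist_zero => //; rewrite -subr_gt0.
have rec0 := @recursion_zero_gap R dl D s Dinf r^-1 kappa c2 c4 c6 a2 (1 - theta ^+ 2) K
  dl_nincr small D_ge0 s_ge0 kappa0 c2_0 c4_0 c6_0 a2_0 t2 gap_rec step_dist_zero D_le.
have rec1 := @recursion_pos_gap R dl D s Dinf r^-1 kappa c1 c2 c4 c5 a2 K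
  dl_nincr small D_ge0 s_ge0 kappa0 c1_0 c2_0 c4_0 c5_0 a2_0 gap_rec step_dist D_le.
split.
- move=> r1; rewrite r1 invr1 in rec0 rec1.
  suff [k dlk] : exists k, dl k = 0.
    exists k; rewrite (objective_dom h c gN (dom k)); congr (_%:E).
    by apply/eqP; rewrite -subr_eq0; apply/eqP.
  have [B B0 HB] : exists2 B, 0 <= B &
      exists N, forall k, (N <= k)%N -> @recursion R dl 1 B 1 k.
    have [D1|D1] := eqVneq Dinf 0; first by apply: rec0 => //; lra.
    by apply: rec1; [rewrite lt_def D1 | lra].
  exact: (@finite_of_recursion R dl 1 dl_ge0 small B 1).
- move=> r1 r2 D1.
  have [B B0 HB] : exists2 B, 0 <= B &
      exists N, forall k, (N <= k)%N -> @recursion R dl r^-1 B (2^-1 + r^-1) k.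
    apply: rec0 => //.
    + by rewrite ltf_pV2 ?posrE//; lra.
    + have : 2^-1 <= r^-1 by rewrite lef_pV2 ?posrE// ltW.
      lra.
  have pE : (r + 2) / (2 * (r - 1)) = (2^-1 + r^-1) / (1 - r^-1).
    by field; rewrite !gt_eqF//; lra.
  have q1 : r^-1 < 1 by rewrite invf_lt1.
  suff p1 : (r + 2) / (2 * (r - 1)) != 1.
    by rewrite pE in p1 *; exact: (order_of_recursion dl_ge0 dl_nincr q1 B0 HB p1).
  by apply/eqP => /(congr1 ( *%R^~ (2 * (r - 1)))); rewrite divfK ?gt_eqF//; lra.
- move=> r1 r2 D1.
  have [B B0 HB] := rec1 D1 ltac:(by rewrite ltf_pV2 ?posrE).
  have pE : 1 / (r - 1) = r^-1 / (1 - r^-1).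
    by field; rewrite !gt_eqF//; lra.
  have q1 : r^-1 < 1 by rewrite invf_lt1.
  suff p1 : 1 / (r - 1) != 1.
    by rewrite pE in p1 *; exact: (order_of_recursion dl_ge0 dl_nincr q1 B0 HB p1).
  by apply/eqP => /(congr1 ( *%R^~ (r - 1))); rewrite divfK ?gt_eqF//; lra.
- move=> r2 r3 D1.
  have r1 : 1 < r by lra.
  have [B B0 HB] : exists2 B, 0 <= B &
      exists N, forall k, (N <= k)%N -> @recursion R dl r^-1 B (2 * r^-1) k.
    apply: rec0 => //.
    + by rewrite ltf_pV2 ?posrE//; lra.
    + have : r^-1 <= 2^-1 by rewrite lef_pV2 ?posrE.
      lra.
  have pE : 2 / (r - 1) = (2 * r^-1) / (1 - r^-1).
    by field; rewrite !gt_eqF//; lra.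
  have q1 : r^-1 < 1 by rewrite invf_lt1.
  suff p1 : 2 / (r - 1) != 1.
    by rewrite pE in p1 *; exact: (order_of_recursion dl_ge0 dl_nincr q1 B0 HB p1).
  by apply/eqP => /(congr1 ( *%R^~ (r - 1))); rewrite divfK ?gt_eqF//; lra.
- move=> r2 D1 D2.
  have k2 : kappa ^+ 2 = (r / gamma) `^ (2 / r) by rewrite /kappa powR_exprn [r^-1 * _]mulrC.
  set w := Num.sqrt Dinf.
  have w0 : 0 < w by rewrite sqrtr_gt0.
  have kappa_gt0 : 0 < kappa by rewrite powR_gt0// divr_gt0.
  have C30 : 0 < 2 * c1 * c2 * kappa ^+ 2.
    have : 0 < c1 by exact: lt_le_trans c1_1.
    have : 0 < c2 by apply: lt_le_trans c2_A; rewrite mulr_gt0.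
    by move=> ? ?; rewrite !mulr_gt0// exprn_gt0.
  (* The hypothesis is the square of [C3 * sqrt Dinf < 1], and [C3] is twice the
     factor needed. *)
  have wlt : c1 * c2 * kappa ^+ 2 * w < 2^-1.
    move: D2; rewrite /C3 -k2 -/c1 -/c2 ltr_pdivlMr ?exprn_gt0// => D2.
    suff : 2 * c1 * c2 * kappa ^+ 2 * w < 1 by lra.
    rewrite -(@ltr_pXn2r R 2) ?nnegrE ?mulr_ge0 ?(ltW w0) ?(ltW C30)//.
    by rewrite expr1n exprMn [w ^+ 2]sqr_sqrtr ?(ltW D1)// mulrC.
  (* Since [C1 >= 1] and [C2] is at least four times [a2], this is a weaker bound. *)
  have alt : a2 * kappa ^+ 2 * w < 4^-1.
    have kw : 0 <= kappa ^+ 2 * w by rewrite mulr_ge0 ?exprn_ge0// ltW.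
    have : a2 * (kappa ^+ 2 * w) <= c1 * c2 / 4 * (kappa ^+ 2 * w).
      apply: ler_wpM2r => //; rewrite /a2.
      have : 1 * c2 <= c1 * c2 by rewrite ler_wpM2r.
      lra.
    lra.
  have [C [k0 [C0 C1' HC]]] := @linear_rate R dl D s Dinf r^-1 kappa c1 c2 c4 c5 a2 K
    dl_ge0 dl_nincr small D_ge0 s_ge0 Dinf0 kappa0 c1_0 c2_0 c4_0 c5_0 a2_0 gap_rec step_dist D_le
    ltac:(by rewrite r2) D1 wlt alt.
  exists C, k0; split => // k k0k; rewrite powRr1; first exact: HC.
  exact: dl_ge0.
Qed.
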